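(* Let $(M,\omega,h)$ be a regular Hamiltonian system with Hamiltonian vector field $X_h$. Let $Y\in\mathfrak{X}(M)$ be an infinitesimal symmetry, that is, $[Y,X_h]=0$, and suppose that for some integer $N\ge 1$ there are functions $f_0,\ldots,f_{N-1}\in C^\infty(M)$ such that $$L(Y)^N\omega=f_0\,\omega+f_1\,L(Y)\omega+\cdots+f_{N-1}\,L(Y)^{N-1}\omega ,$$ where the $2$-forms $\omega,L(Y)\omega,\ldots,L(Y)^{N-1}\omega$ are independent. 1. If $f_0,\ldots,f_{N-1}$ are not all constant functions, then those functions $f_j$ that are non-constant are (non-trivial) local conserved quantities, i.e. $L(X_h)f_j=0$. 2. Suppose that $f_0,\ldots,f_{N-1}$ are all constant functions, with $f_0=0$ and some of the others non-vanishing, so that, writing $f_j=C_j\in\mathbb{R}$, $$L(Y)^N\omega=C_1L(Y)\omega+\cdots+C_{N-1}L(Y)^{N-1}\omega ,$$ and suppose that $L(Y)h=0$. Then: (a) The $1$-form $$\gamma=L(Y)^{N-1}\big(i(Y)\omega\big)-C_{N-1}L(Y)^{N-2}\big(i(Y)\omega\big)-\cdots-C_1\,i(Y)\omega$$ is closed. Consequently, for every $p\in M$ there exist an open neighbourhood $U_p\ni p$ and a function $f\in C^\infty(U_p)$ (unique up to a constant) such that $\gamma=\mathrm{d}f$ on $U_p$. (b) $f$ is a local conserved quantity, i.e. $L(X_h)f=0$ on $U_p$.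
   Context: All manifolds are real, finite-dimensional, paracompact, connected and $C^\infty$; all maps are $C^\infty$. $\mathfrak{X}(M)$ is the set of smooth vector fields on $M$, $i(Y)$ denotes contraction with the vector field $Y$, $L(Y)$ the Lie derivative along $Y$, and $L(Y)^k$ its $k$-fold iterate (with $L(Y)^0$ the identity). A regular Hamiltonian system is a triple $(M,\omega,h)$ where $(M,\omega)$ is a symplectic manifold and $h\in C^\infty(M)$ is the Hamiltonian function. Its Hamiltonian vector field $X_h\in\mathfrak{X}(M)$ is the unique vector field with $i(X_h)\omega=\mathrm{d}h$. A vector field $Y\in\mathfrak{X}(M)$ is an infinitesimal symmetry if $[Y,X_h]=0$; it is an infinitesimal Hamiltonian symmetry if $L(Y)h=0$. A function is a conserved quantity (on the open set where it is defined) if its Lie derivative along $X_h$ vanishes there. ''Independent'' for the $2$-forms means linearly independent over smooth functions, in the module of $2$-forms: if $\sum_{j=0}^{N-1}g_j\,L(Y)^j\omega=0$ with $g_j\in C^\infty(M)$, then all $g_j=0$. *)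

(* Defs.v *)
From mathcomp Require Export all_boot all_order all_algebra.
From mathcomp Require Export all_classical all_reals all_analysis.
Export Order.TTheory GRing.Theory Num.Theory.
Export numFieldNormedType.Exports.

Set Implicit Arguments.
Unset Strict Implicit.
Unset Printing Implicit Defensive.

Local Open Scope classical_set_scope.
Local Open Scope ring_scope.

(* Euclidean n-space is 'rV[R]_n (MathComp-Analysis). *)

Definition paracompact (T : topologicalType) : Prop :=
  forall F : set (set T),
    (forall A, F A -> open A) -> \bigcup_(A in F) A = setT ->
  exists G : set (set T),
    [/\ forall A, G A -> open A,
        \bigcup_(A in G) A = setT,
        forall A, G A -> exists2 B, F B & A `<=` B
      & forall x : T, exists2 V : set T, nbhs x V &
          finite_set (G `&` [set A | A `&` V !=set0])].

(* For k > 0 the derivative is Frechet, and it is of class C^(k-1) because its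
   value in each fixed direction is, the source being finite-dimensional.
   The set V is meant to be open. *)
Fixpoint class_C (R : realType) (n : nat) (W : normedModType R) (k : nat)
    (V : set 'rV[R]_n) (f : 'rV[R]_n -> W) : Prop :=
  if k is k'.+1 then
    (forall x, V x -> differentiable f x) /\
    (forall v, class_C k' V (fun x => 'D_v f x))
  else forall x, V x -> {for x, continuous f}.

Definition smooth (R : realType) (n : nat) (W : normedModType R)
    (V : set 'rV[R]_n) (f : 'rV[R]_n -> W) : Prop :=
  forall k, class_C k V f.

(* A homeomorphism from an open subset [cdom] of T to an open subset [cimg] of
   R^n, with inverse [cinv]; the values of [cmap] outside [cdom] and of [cinv]
   outside [cimg] are irrelevant. *)
Record local_chart (R : realType) (n : nat) (T : topologicalType) :=
  LocalChart {
    cdom : set T;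
    cimg : set 'rV[R]_n;
    cmap : T -> 'rV[R]_n;
    cinv : 'rV[R]_n -> T;
    cdom_open : open cdom;
    cimg_open : open cimg;
    cmap_img : forall p, cdom p -> cimg (cmap p);
    cinv_dom : forall x, cimg x -> cdom (cinv x);
    cmapK : forall p, cdom p -> cinv (cmap p) = p;
    cinvK : forall x, cimg x -> cmap (cinv x) = x;
    cmap_cont : forall p, cdom p -> {for p, continuous cmap};
    cinv_cont : forall x, cimg x -> {for x, continuous cinv} }.

Definition overlap (R : realType) (n : nat) (T : topologicalType)
    (a b : local_chart R n T) : set 'rV[R]_n :=
  [set x | cimg a x /\ cdom b (cinv a x)].

Definition transition (R : realType) (n : nat) (T : topologicalType)
    (a b : local_chart R n T) (x : 'rV[R]_n) : 'rV[R]_n := cmap b (cinv a x).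

(* The smooth structure is given by an indexed, not necessarily maximal,
   atlas. *)
Record manifold (R : realType) (n : nat) := Manifold {
  mspace :> topologicalType;
  mhausdorff : hausdorff_space mspace;
  mparacompact : paracompact mspace;
  mconnected : connected [set: mspace];
  mindex : Type;
  mchart : mindex -> local_chart R n mspace;
  mcover : forall p, exists c, cdom (mchart c) p;
  mtransition : forall a b,
    smooth (overlap (mchart a) (mchart b))
           (transition (mchart a) (mchart b)) }.

(* A function defined on an open set U is represented by any of its extensions
   to M; only its values on U matter. *)
Definition smooth_fun (R : realType) (n : nat) (M : manifold R n)
    (U : set M) (f : M -> R) : Prop :=
  forall c : mindex M,
    smooth [set x | cimg (mchart c) x /\ U (cinv (mchart c) x)]
           (fun x => f (cinv (mchart c) x) : R^o).

Definition is_constant (T : Type) (R : realType) (f : T -> R) : Prop :=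
  exists a, forall p, f p = a.

(* A vector field or a k-form on M is given by its expressions in all the charts
   of the atlas, subject to the usual transformation law under change of chart.
   Values outside the image of a chart are irrelevant. *)
Definition vfield_expr (R : realType) (n : nat) (M : manifold R n) : Type :=
  mindex M -> 'rV[R]_n -> 'rV[R]_n.

Definition vector_field (R : realType) (n : nat) (M : manifold R n)
    (Y : vfield_expr M) : Prop :=
  (forall c, smooth (cimg (mchart c)) (Y c)) /\
  (forall a b x, overlap (mchart a) (mchart b) x ->
    Y b (transition (mchart a) (mchart b) x) =
    'D_(Y a x) (transition (mchart a) (mchart b)) x).

Definition form_expr (R : realType) (n : nat) (M : manifold R n) (k : nat)
    : Type :=
  mindex M -> 'rV[R]_n -> ('I_k -> 'rV[R]_n) -> R.

Definition differential_form (R : realType) (n : nat) (M : manifold R n)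
    (k : nat) (alpha : form_expr M k) : Prop :=
  [/\ forall c x, cimg (mchart c) x -> forall v (i : 'I_k) a u w,
        alpha c x (dfwith v i (a *: u + w)) =
        a * alpha c x (dfwith v i u) + alpha c x (dfwith v i w),
      forall c x, cimg (mchart c) x -> forall v (i j : 'I_k),
        i != j -> v i = v j -> alpha c x v = 0,
      forall c v, smooth (cimg (mchart c)) (fun x => alpha c x v : R^o)
    & forall a b x, overlap (mchart a) (mchart b) x -> forall v,
        alpha a x v =
        alpha b (transition (mchart a) (mchart b) x)
          (fun i => 'D_(v i) (transition (mchart a) (mchart b)) x)].

Definition form_eq_on (R : realType) (n : nat) (M : manifold R n) (k : nat)
    (U : set M) (alpha beta : form_expr M k) : Prop :=
  forall c x, cimg (mchart c) x -> U (cinv (mchart c) x) ->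
    forall v, alpha c x v = beta c x v.

Definition form0 (R : realType) (n : nat) (M : manifold R n) (k : nat)
  : form_expr M k := fun _ _ _ => 0.

Definition form_sub (R : realType) (n : nat) (M : manifold R n) (k : nat)
    (alpha beta : form_expr M k) : form_expr M k :=
  fun c x v => alpha c x v - beta c x v.

Definition form_comb (R : realType) (n : nat) (M : manifold R n) (k N : nat)
    (P : pred 'I_N) (g : 'I_N -> M -> R) (alpha : 'I_N -> form_expr M k)
  : form_expr M k :=
  fun c x v => \sum_(j < N | P j) g j (cinv (mchart c) x) * alpha j c x v.

Definition fun_form (R : realType) (n : nat) (M : manifold R n) (f : M -> R)
  : form_expr M 0 := fun c x _ => f (cinv (mchart c) x).

Definition vcons (T : Type) (k : nat) (u : T) (v : 'I_k -> T) : 'I_k.+1 -> T :=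
  fun i => oapp v u (unlift ord0 i).

Definition contraction (R : realType) (n : nat) (M : manifold R n) (k : nat)
    (Y : vfield_expr M) (alpha : form_expr M k.+1) : form_expr M k :=
  fun c x v => alpha c x (vcons (Y c x) v).

(* In a chart, d alpha evaluated on constant vector fields v_0, ..., v_k, whose
   brackets vanish. *)
Definition ext_d (R : realType) (n : nat) (M : manifold R n) (k : nat)
    (alpha : form_expr M k) : form_expr M k.+1 :=
  fun c x v =>
    \sum_(i < k.+1) (-1) ^+ i *
      'D_(v i) (fun y => alpha c y (fun j => v (lift i j)) : R^o) x.

(* In coordinates, (L_Y alpha)_{i1..ik} = Y^m d_m alpha_{i1..ik}
   + sum_j (d_{ij} Y^m) alpha_{i1..m..ik}, with m in the j-th slot; for k = 0
   this is the derivative of a function along Y. *)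
Definition lie (R : realType) (n : nat) (M : manifold R n) (k : nat)
    (Y : vfield_expr M) (alpha : form_expr M k) : form_expr M k :=
  fun c x v =>
    'D_(Y c x) (fun y => alpha c y v : R^o) x +
    \sum_(j < k) alpha c x (dfwith v j ('D_(v j) (Y c) x)).

Definition lie_bracket (R : realType) (n : nat) (M : manifold R n)
    (Y X : vfield_expr M) : vfield_expr M :=
  fun c x => 'D_(Y c x) (X c) x - 'D_(X c x) (Y c) x.

Definition closed_form (R : realType) (n : nat) (M : manifold R n) (k : nat)
    (alpha : form_expr M k) : Prop :=
  form_eq_on setT (ext_d alpha) (@form0 R n M k.+1).

Definition nondegenerate (R : realType) (n : nat) (M : manifold R n)
    (omega : form_expr M 2) : Prop :=
  forall c x, cimg (mchart c) x -> forall u : 'rV[R]_n,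
    (forall w, omega c x (vcons u (fun=> w)) = 0) -> u = 0.

Definition symplectic (R : realType) (n : nat) (M : manifold R n)
    (omega : form_expr M 2) : Prop :=
  [/\ differential_form omega, closed_form omega & nondegenerate omega].

Definition hamiltonian_vector_field (R : realType) (n : nat) (M : manifold R n)
    (omega : form_expr M 2) (h : M -> R) (X : vfield_expr M) : Prop :=
  vector_field X /\
  form_eq_on setT (contraction X omega) (ext_d (fun_form h)).

Definition infinitesimal_symmetry (R : realType) (n : nat) (M : manifold R n)
    (X Y : vfield_expr M) : Prop :=
  forall c x, cimg (mchart c) x -> lie_bracket Y X c x = 0.

Definition infinitesimal_hamiltonian_symmetry (R : realType) (n : nat)
    (M : manifold R n) (h : M -> R) (Y : vfield_expr M) : Prop :=
  form_eq_on setT (lie Y (fun_form h)) (@form0 R n M 0).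

Definition conserved_on (R : realType) (n : nat) (M : manifold R n)
    (X : vfield_expr M) (U : set M) (f : M -> R) : Prop :=
  form_eq_on U (lie X (fun_form f)) (@form0 R n M 0).

Definition independent_forms (R : realType) (n : nat) (M : manifold R n)
    (k N : nat) (alpha : 'I_N -> form_expr M k) : Prop :=
  forall g : 'I_N -> M -> R,
    (forall j, smooth_fun setT (g j)) ->
    form_eq_on setT (form_comb xpredT g alpha) (@form0 R n M k) ->
    forall j p, g j p = 0.

Definition potential_on (R : realType) (n : nat) (M : manifold R n)
    (gamma : form_expr M 1) (U : set M) (f : M -> R) : Prop :=
  [/\ open U, smooth_fun U f & form_eq_on U gamma (ext_d (fun_form f))].

(* L(Y)^(N-1) (i(Y) omega) - sum_(0 < j < N) C_j L(Y)^(j-1) (i(Y) omega) *)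
Definition symmetry_form (R : realType) (n : nat) (M : manifold R n)
    (omega : form_expr M 2) (Y : vfield_expr M) (N : nat) (C : 'I_N -> R)
  : form_expr M 1 :=
  form_sub (iter N.-1 (lie Y) (contraction Y omega))
    (form_comb (fun j : 'I_N => (0 < j)%N) (fun j => cst (C j))
       (fun j => iter j.-1 (lie Y) (contraction Y omega))).

(* Main.v *)
(** In a chart, let [beta_j = L(Y)^j (i(Y) omega)].  Since [omega] is closed,
    [L(Y) omega = d beta_0], and since [L(Y)] commutes with [d] on 1-forms,
    [L(Y)^(j+1) omega = d beta_j]; thus only Lie derivatives of 1-forms have to
    be understood.  [L(X) omega = d d h = 0] and [[Y, X] = 0] give
    [L(X) beta_j = 0], hence [L(X) L(Y)^j omega = 0] for all [j].  Applying
    [L(X)] to the linear relation leaves [sum_j (L(X) f_j) L(Y)^j omega = 0], and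
    independence yields part 1.

    For part 2, [d gamma] is the linear relation itself, so [gamma] is closed.
    Its local potentials come from the radial formula
    [F x = \int_0^1 gamma (x0 + t (x - x0)) (x - x0) dt], and they are conserved
    because [i(X) beta_j = L(Y)^j (i(X) i(Y) omega) = - L(Y)^j (L(Y) h) = 0].  All
    symmetries of second derivatives rest on Schwarz's theorem, proved here by
    applying the mean value theorem twice. *)

From mathcomp Require Import ring.
Require Import Defs.

Set Implicit Arguments.
Unset Strict Implicit.
Unset Printing Implicit Defensive.

Local Open Scope classical_set_scope.
Local Open Scope ring_scope.

(** * Directional derivatives *)

Section directional_derivative.
Context {R : realType} {n : nat}.
Local Notation E := 'rV[R]_n.

(** Expressions of fields and forms are total functions that mean something only on a chart image,
    so an identity holds on an open set [V] and has to be localised before it can be differentiated.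
    Smoothness of a form is known only for fixed arguments; a form applied to a varying field is
    expanded in the standard basis, which gives the product rule behind every formula with [L(Y)].
    Passing through 1-forms spares a parallel theory for 2-forms, where bilinearity, smoothness and
    antisymmetry would have to be propagated along the iteration. Two steps leave the single chart.
    Independence quantifies over functions on [M], so [L(X) f_j] has to be glued from its chart
    expressions. And a potential built in one chart must have differential [gamma] in all the
    others, which requires the transformation law of [L(Y)^j (i(Y) omega)]. *)

Lemma derive_linear (W : normedModType R) (f : E -> W) x a u w :
  differentiable f x -> 'D_(a *: u + w) f x = a *: 'D_u f x + 'D_w f x.
Proof. by move=> df; rewrite !deriveE// linearP. Qed.

Lemma derive_comp m (W : normedModType R) (g : E -> 'rV[R]_m)
    (f : 'rV[R]_m -> W) x v :
  differentiable g x -> differentiable f (g x) ->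
  'D_v (f \o g) x = 'D_('D_v g x) f (g x).
Proof.
move=> dg df; rewrite (deriveE v (differentiable_comp dg df)) diff_comp//=.
by rewrite (deriveE _ df) (deriveE _ dg).
Qed.

Lemma derive_coord m (F : E -> 'rV[R]_m) x v i :
  differentiable F x -> ('D_v F x) 0 i = 'D_v (fun y => F y 0 i : R^o) x.
Proof. by move=> dF; rewrite derive_mx ?mxE//; exact: diff_derivable. Qed.

Lemma differentiable_comp_coord m (F : E -> 'rV[R]_m) x i :
  differentiable F x -> differentiable (fun y => F y 0 i : R^o) x.
Proof.
by move=> dF; exact: (differentiable_comp dF (differentiable_coord (F x) 0 i)).
Qed.

(** The first-order expansion of [f] at [x] involves only the germ of [f], so it is also an
    expansion of [g]; uniqueness of the differential then identifies ['d g x] with ['d f x]. *)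
Lemma near_eq_differentiable (W : normedModType R) (f g : E -> W) x :
  (\near x, f x = g x) -> differentiable f x -> differentiable g x.
Proof.
move=> fg df.
have [cdf /eqaddoP fE] := (diff_locallyP _ _).1 df.
have gE : g \o shift x = cst (g x) + 'd f x +o_ (0 : E) id.
  apply/eqaddoP => e e0; near=> y.
  have -> : (g \o shift x - (cst (g x) + 'd f x)) y =
     (f \o shift x - (cst (f x) + 'd f x)) y.
    rewrite !fctE /= -(nbhs_singleton fg); congr (_ - _); apply/esym.
    by near: y; move: fg; rewrite (near_shift 0) subr0.
  by near: y; exact: fE.
have dgE := diff_unique cdf gE.
by apply/diff_locallyP; rewrite dgE.
Unshelve. all: by end_near. Qed.

Lemma derive_mul (f g : E -> R^o) x v :
  differentiable f x -> differentiable g x ->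
  'D_v (fun y => f y * g y : R^o) x = f x * 'D_v g x + g x * 'D_v f x.
Proof. by move=> df dg; rewrite deriveM//; exact: diff_derivable. Qed.

Lemma derive_bigsum (W : normedModType R) m (f : 'I_m -> E -> W) x v :
  (forall i, differentiable (f i) x) ->
  'D_v (fun y => \sum_i f i y) x = \sum_i 'D_v (f i) x.
Proof.
move=> df; rewrite -derive_sum//; last by move=> i; exact: diff_derivable.
by congr ('D_v _ x); apply/funext => y; rewrite fct_sumE.
Qed.

Lemma differentiable_bigsum (W : normedModType R) m (f : 'I_m -> E -> W) x :
  (forall i, differentiable (f i) x) ->
  differentiable (fun y => \sum_i f i y) x.
Proof.
move=> df; rewrite (_ : (fun y => _) = \sum_i f i); first exact: differentiable_sum.
by apply/funext => y; rewrite fct_sumE.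
Qed.

Lemma differentiable_mul (f g : E -> R^o) x :
  differentiable f x -> differentiable g x ->
  differentiable (fun y => f y * g y : R^o) x.
Proof. exact: differentiableM. Qed.

Definition linear_on (V : set E) (a : E -> E -> R) :=
  forall x, V x -> forall c u w, a x (c *: u + w) = c * a x u + a x w.

Lemma linear_on_sum V a : linear_on V a -> forall x, V x ->
  forall m (c : 'I_m -> R) (w : 'I_m -> E),
  a x (\sum_i c i *: w i) = \sum_i c i * a x (w i).
Proof.
move=> la x Vx m c w; elim: m c w => [|m IH] c w.
  rewrite !big_ord0.
  (* The coefficient -1 with both vectors zero forces the value 0 at the zero vector. *)
  have := la x Vx (-1) 0 0; rewrite scaler0 addr0 mulN1r addNr => //.
by rewrite !big_ord_recl la// IH.
Qed.

Lemma linear_on_coord V a : linear_on V a -> forall x, V x -> forall w : E,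
  a x w = \sum_i w 0 i * a x (delta_mx 0 i).
Proof. by move=> la x Vx w; rewrite {1}(row_sum_delta w) (linear_on_sum la). Qed.

Section product_rule.
Variables (V : set E) (a : E -> E -> R^o) (Z : E -> E) (x : E).
Hypotheses (Vo : open V) (la : linear_on V a) (Vx : V x)
  (da : forall v, differentiable (a ^~ v) x) (dZ : differentiable Z x).

(** Near [x] the composite is a finite sum of products of scalar functions, so differentiability of
    [a ^~ v] for each fixed [v] suffices for the product rule. *)
Let near_coord : \near x, \sum_i Z x 0 i * a x (delta_mx 0 i) = a x (Z x).
Proof.
near=> y; rewrite -(linear_on_coord la)//.
by near: y; exact: open_nbhs_nbhs.
Unshelve. all: by end_near. Qed.

Lemma differentiable_apply : differentiable (fun y => a y (Z y)) x.
Proof.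
apply: (near_eq_differentiable near_coord).
apply: differentiable_bigsum => i; apply: differentiable_mul => //.
exact: differentiable_comp_coord.
Qed.

Lemma derive_apply u :
  'D_u (fun y => a y (Z y)) x = 'D_u (a ^~ (Z x)) x + a x ('D_u Z x).
Proof.
rewrite -(near_eq_derive u near_coord) derive_bigsum; last first.
  by move=> i; apply: differentiable_mul => //; exact: differentiable_comp_coord.
under eq_bigr => i _.
  rewrite derive_mul//; last exact: differentiable_comp_coord.
  rewrite -derive_coord// [X in _ + X]mulrC; over.
rewrite big_split/= -(linear_on_coord la)//; congr (_ + _).
(* The same expansion with the coordinates frozen at [Z x] recovers the derivative of [a] in a fixed
   argument. *)
rewrite (@near_eq_derive _ _ _ (a ^~ (Z x))
   (fun y => \sum_i Z x 0 i * a y (delta_mx 0 i))).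
  rewrite derive_bigsum; last first.
    move=> i; apply: (differentiable_mul (differentiable_cst (Z x 0 i : R^o) x)); exact: da.
  apply: eq_bigr => i _; rewrite (derive_mul u (differentiable_cst (Z x 0 i : R^o) x) (da _)).
  by rewrite [X in _ + _ * X](derive_cst (Z x 0 i : R^o)) mulr0 addr0.
near=> y; rewrite -(linear_on_coord la)//.
by near: y; exact: open_nbhs_nbhs.
Unshelve. all: by end_near. Qed.

End product_rule.

End directional_derivative.

(** * Smooth functions *)

Section smooth_functions.
Context {R : realType} {n : nat}.
Local Notation E := 'rV[R]_n.
Implicit Types (V : set E) (W : normedModType R).

Lemma near_open V (P : E -> Prop) x :
  open V -> V x -> (forall y, V y -> P y) -> \near x, P x.
Proof.
by move=> Vo Vx VP; near=> y; apply: VP; near: y; exact: open_nbhs_nbhs.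
Unshelve. all: by end_near. Qed.

Lemma eq_derive_on V W (f g : E -> W) x v : open V -> V x ->
  (forall y, V y -> f y = g y) -> 'D_v f x = 'D_v g x.
Proof. by move=> Vo Vx fg; apply: near_eq_derive; exact: near_open fg. Qed.

Lemma eq_differentiable_on V W (f g : E -> W) x : open V -> V x ->
  (forall y, V y -> f y = g y) -> differentiable f x -> differentiable g x.
Proof.
by move=> Vo Vx fg; apply: near_eq_differentiable; exact: near_open fg.
Qed.

(** Openness of [V] lets agreement on [V] pass to the derivatives, hence through the induction. *)
Lemma eq_class_C V W k (f g : E -> W) : open V ->
  (forall y, V y -> f y = g y) -> class_C k V f -> class_C k V g.
Proof.
move=> Vo; elim: k f g => [|k IH] f g fg /=.
  move=> cf x Vx; rewrite /prop_for /continuous_at -(fg _ Vx).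
  have gf : \near x, f x = g x by exact: near_open fg.
  by apply: cvg_trans (cf x Vx); exact: (near_eq_cvg gf).
move=> [df Df]; split=> [x Vx|v].
  exact: eq_differentiable_on fg (df x Vx).
by apply: IH (Df v) => y Vy; exact: eq_derive_on fg.
Qed.

Lemma eq_smooth V W (f g : E -> W) : open V ->
  (forall y, V y -> f y = g y) -> smooth V f -> smooth V g.
Proof. by move=> Vo fg sf k; apply: eq_class_C fg _. Qed.

Lemma sub_class_C V V' W k (f : E -> W) :
  V' `<=` V -> class_C k V f -> class_C k V' f.
Proof.
move=> V'V; elim: k f => [|k IH] f /=; first by move=> cf x /V'V; exact: cf.
by move=> [df Df]; split=> [x /V'V|v]; [exact: df|exact: IH].
Qed.

Lemma sub_smooth V V' W (f : E -> W) : V' `<=` V -> smooth V f -> smooth V' f.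
Proof. by move=> V'V sf k; exact: sub_class_C (sf k). Qed.

Lemma class_CS V W k (f : E -> W) : class_C k.+1 V f -> class_C k V f.
Proof.
elim: k f => [|k IH] f [df Df].
  by move=> x Vx; apply/differentiable_continuous/df.
by split=> // v; apply: IH; exact: Df.
Qed.

Lemma smooth_differentiable V W (f : E -> W) x :
  smooth V f -> V x -> differentiable f x.
Proof. by move=> /(_ 1)[df _]; exact: df. Qed.

Lemma smooth_derive V W (f : E -> W) v : smooth V f -> smooth V ('D_v f).
Proof. by move=> sf k; have [_] := sf k.+1; exact. Qed.

Lemma smooth_continuous V W (f : E -> W) x :
  smooth V f -> V x -> {for x, continuous f}.
Proof. by move=> /(_ 0); exact. Qed.

Lemma smooth_intro V W (f : E -> W) :
  (forall x, V x -> differentiable f x) -> (forall v, smooth V ('D_v f)) ->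
  smooth V f.
Proof.
move=> df Df; case=> [|k]; last by split=> // v; exact: Df.
by move=> x Vx; apply/differentiable_continuous/df.
Qed.

Lemma class_C_cst V W k (a : W) : class_C k V (fun=> a).
Proof.
elim: k a => [|k IH] a; first by move=> x _; exact: cst_continuous.
split=> [x _|v]; first exact: differentiable_cst.
have -> : 'D_v (fun _ : E => a) = fun=> 0.
  by apply/funext => x; exact: derive_cst.
exact: IH.
Qed.

Lemma smooth_cst V W (a : W) : smooth V (fun=> a).
Proof. by move=> k; exact: class_C_cst. Qed.

Lemma class_CD V W k (f g : E -> W) : open V ->
  class_C k V f -> class_C k V g -> class_C k V (fun x => f x + g x).
Proof.
move=> Vo; elim: k f g => [|k IH] f g /=.
  by move=> cf cg x Vx; apply: continuousD; [exact: cf|exact: cg].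
move=> [df Df] [dg Dg]; split=> [x Vx|v].
  by apply: differentiableD; [exact: df|exact: dg].
apply: eq_class_C (IH _ _ (Df v) (Dg v)) => // x Vx /=.
by rewrite -deriveD//; apply: diff_derivable; [exact: df|exact: dg].
Qed.

Lemma smoothD V W (f g : E -> W) : open V ->
  smooth V f -> smooth V g -> smooth V (fun x => f x + g x).
Proof. by move=> Vo sf sg k; exact: class_CD. Qed.

Lemma class_CM V k (f g : E -> R^o) : open V ->
  class_C k V f -> class_C k V g -> class_C k V (fun x => f x * g x : R^o).
Proof.
move=> Vo; elim: k f g => [|k IH] f g.
  by move=> cf cg x Vx; apply: continuousM; [exact: cf|exact: cg].
move=> Cf Cg; have [df Df] := Cf; have [dg Dg] := Cg; split=> [x Vx|v].
  by apply: differentiable_mul; [exact: df|exact: dg].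
have h := class_CD Vo (IH _ _ (class_CS Cf) (Dg v)) (IH _ _ (class_CS Cg) (Df v)).
apply: eq_class_C h => // x Vx /=.
by rewrite derive_mul//; [exact: df|exact: dg].
Qed.

Lemma smoothM V (f g : E -> R^o) : open V ->
  smooth V f -> smooth V g -> smooth V (fun x => f x * g x : R^o).
Proof. by move=> Vo sf sg k; exact: class_CM. Qed.

Lemma smooth_sum V W m (f : 'I_m -> E -> W) : open V ->
  (forall i, smooth V (f i)) -> smooth V (fun x => \sum_i f i x).
Proof.
move=> Vo; elim: m f => [|m IH] f sf.
  apply: (eq_smooth Vo _ (smooth_cst V (0 : W))) => x _.
  by rewrite big_ord0.
apply: (eq_smooth Vo _ (smoothD Vo (sf ord0) (IH _ (fun i => sf (lift ord0 i))))).
by move=> x _; rewrite big_ord_recl.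
Qed.

Lemma smooth_coord V m (F : E -> 'rV[R]_m) i : open V ->
  smooth V F -> smooth V (fun x => F x 0 i : R^o).
Proof.
move=> Vo sF k; elim: k F sF => [|k IH] F sF.
  move=> x Vx; apply: differentiable_continuous.
  by apply: differentiable_comp_coord; exact: smooth_differentiable sF Vx.
split=> [x Vx|v].
  by apply: differentiable_comp_coord; exact: smooth_differentiable sF Vx.
apply: eq_class_C (IH _ (smooth_derive v sF)) => // x Vx.
by rewrite derive_coord//; exact: smooth_differentiable sF Vx.
Qed.

Lemma smooth_apply V (a : E -> E -> R^o) (Z : E -> E) : open V ->
  linear_on V a -> (forall v, smooth V (a ^~ v)) -> smooth V Z ->
  smooth V (fun x => a x (Z x)).
Proof.
move=> Vo la sa sZ.
apply: (@eq_smooth _ _ (fun x => \sum_i Z x 0 i * a x (delta_mx 0 i))) => //.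
  by move=> x Vx; rewrite -(linear_on_coord la).
by apply: smooth_sum => // i; apply: smoothM => //; exact: smooth_coord.
Qed.

(** Presents the differential of [f] as a family linear in its vector; derivatives along
    non-constant fields thereby become instances of the product rule. *)
Lemma derive_linear_on V (f : E -> R^o) :
  (forall x, V x -> differentiable f x) -> linear_on V (fun x v => 'D_v f x).
Proof. by move=> df x Vx c u w; rewrite derive_linear//; exact: df. Qed.

Lemma smooth_derive_along V (f : E -> R^o) (Z : E -> E) : open V ->
  smooth V f -> smooth V Z -> smooth V (fun x => 'D_(Z x) f x).
Proof.
move=> Vo sf sZ; apply: (@smooth_apply V (fun x v => 'D_v f x)) => //.
  by apply: derive_linear_on => x; exact: smooth_differentiable.
by move=> v; exact: smooth_derive.
Qed.

Lemma derive_derive_along V (f : E -> R^o) (Z : E -> E) x u : open V -> V x ->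
  smooth V f -> differentiable Z x ->
  'D_u (fun y => 'D_(Z y) f y) x = 'D_u ('D_(Z x) f) x + 'D_('D_u Z x) f x.
Proof.
move=> Vo Vx sf dZ.
rewrite (@derive_apply _ _ V (fun x v => 'D_v f x))//.
  by apply: derive_linear_on => y; exact: smooth_differentiable.
by move=> v; exact: (smooth_differentiable (smooth_derive v sf)).
Qed.

End smooth_functions.

(** * Schwarz's theorem *)

Section mixed_derivatives.
Context {R : realType} {n : nat}.
Local Notation E := 'rV[R]_n.
Implicit Types (V : set E) (f : E -> R^o).

(** The difference quotient of the restriction to the line is that of [f] along [v]. Derivability in
    the single direction [v] is enough, so this also serves functions not yet known to be Frechet
    differentiable. *)
Lemma is_derive_line f x v (t : R) : derivable f (x + t *: v) v ->
  is_derive t 1 (fun s : R => f (x + s *: v)) ('D_v f (x + t *: v)).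
Proof.
move=> dfv.
have fE : (fun h : R => h^-1 *: (f (x + (h *: (1 : R^o) + t) *: v) - f (x + t *: v))) =
          (fun h : R => h^-1 *: (f (h *: v + (x + t *: v)) - f (x + t *: v))).
  apply/funext => h; rewrite scalerDl addrCA; congr (h^-1 *: (f (_ *: _ + _) - _)).
  by rewrite /GRing.scale/= mulr1.
by apply: DeriveDef; [rewrite /derivable fE|rewrite /derive fE].
Qed.

Lemma MVT_line f x v :
  (forall t : R, 0 <= t <= 1 -> derivable f (x + t *: v) v) ->
  exists2 t : R, 0 <= t <= 1 & f (x + v) - f x = 'D_v f (x + t *: v).
Proof.
move=> df.
have dline (t : R) : t \in `[0, 1]%R ->
    is_derive t 1 (fun s : R => f (x + s *: v)) ('D_v f (x + t *: v)).
  by rewrite in_itv/= => t01; apply: is_derive_line; exact: df.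
pose g (s : R) : R := f (x + s *: v); pose dg (t : R) : R := 'D_v f (x + t *: v).
have d1 (t : R) : t \in `]0, 1[%R -> is_derive (t : R^o) 1 (g : R^o -> R^o) (dg t).
  by move=> t01; apply: dline; exact: subset_itv_oo_cc.
have cg : {within `[0, 1], continuous g}.
  apply: derivable_within_continuous => t t01; have := dline t t01.
  by move=> [].
have [t t01 E1] := @MVT R g dg 0 1 ltr01 d1 cg.
exists t; first by have := subset_itv_oo_cc t01; rewrite /= in_itv.
by move: E1; rewrite /g /dg scale1r scale0r addr0 subr0 mulr1.
Qed.

Lemma second_difference V f x u v : open V -> smooth V f ->
  (forall s t : R, 0 <= s <= 1 -> 0 <= t <= 1 -> V (x + s *: u + t *: v)) ->
  exists s t : R, [/\ 0 <= s <= 1, 0 <= t <= 1 &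
    f (x + u + v) - f (x + v) - (f (x + u) - f x) =
    'D_v ('D_u f) (x + s *: u + t *: v)].
Proof.
move=> Vo sf Vst.
have df (s t : R) : 0 <= s <= 1 -> 0 <= t <= 1 -> differentiable f (x + s *: u + t *: v).
  by move=> s01 t01; apply: smooth_differentiable sf _; exact: Vst.
have i0 : 0 <= (0 : R) <= 1 by rewrite lexx ler01.
have i1 : 0 <= (1 : R) <= 1 by rewrite lexx ler01.
have dv (s : R) : 0 <= s <= 1 -> differentiable (fun y => f (y + v)) (x + s *: u).
  move=> s01; have := df s 1 s01 i1; rewrite scale1r => dfs.
  have dsh : differentiable (fun y : E => y + v) (x + s *: u).
    exact: (differentiableD (@ex_diff _ _ _ _ _ _ _ (is_diff_id _)) (differentiable_cst v _)).
  exact: (differentiable_comp dsh dfs).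
have d0 (s : R) : 0 <= s <= 1 -> differentiable f (x + s *: u).
  by move=> s01; have := df s 0 s01 i0; rewrite scale0r addr0.
have [s s01] := @MVT_line (fun y => f (y + v) - f y) x u
  (fun s s01 => diff_derivable (differentiableB (dv s s01) (d0 s s01))).
(* Regrouped as the increment in direction [u] of [y |-> f (y + v) - f y], to which the mean value
   theorem was applied. *)
have -> : f (x + u + v) - f (x + v) - (f (x + u) - f x) =
    f (x + u + v) - f (x + u) - (f (x + v) - f x) by ring.
move=> ->; have dsv := dv s s01; have ds0 := d0 s s01.
rewrite deriveB; [|exact: diff_derivable|exact: diff_derivable].
have -> : 'D_u (fun y => f (y + v)) (x + s *: u) = 'D_u f (x + s *: u + v).
  have fE : (fun h : R => h^-1 *: (f (h *: u + (x + s *: u) + v) - f (x + s *: u + v)))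
    = (fun h : R => h^-1 *: (f (h *: u + (x + s *: u + v)) - f (x + s *: u + v))).
    by apply/funext => h; rewrite -(addrA (h *: u)).
  by rewrite /derive fE.
have sDf := smooth_derive u sf.
have [t t01 ->] := @MVT_line ('D_u f) (x + s *: u) v
  (fun t t01 => diff_derivable (smooth_differentiable sDf (Vst s t s01 t01))).
by exists s, t.
Qed.

(** The second difference is symmetric in [u] and [v], so computing it in both orders equates the
    two mixed derivatives, though at different intermediate points. The bounds keep these points
    close to [x], where continuity can merge them. *)
Lemma derive_commute_scaled V f x u v : open V -> smooth V f ->
  (forall s t : R, 0 <= s <= 1 -> 0 <= t <= 1 -> V (x + s *: u + t *: v)) ->
  exists p q : E, [/\ V p, V q, `|x - p| <= `|u| + `|v|, `|x - q| <= `|u| + `|v|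
    & 'D_v ('D_u f) p = 'D_u ('D_v f) q].
Proof.
move=> Vo sf Vst.
have xst (w z : E) (s t : R) : 0 <= s <= 1 -> 0 <= t <= 1 ->
    `|x - (x + s *: w + t *: z)| <= `|w| + `|z|.
  move=> /andP[s0 s1] /andP[t0 t1].
  rewrite -addrA opprD addNKr normrN (le_trans (ler_normD _ _))// lerD//.
    by rewrite normrZ ger0_norm// ler_piMl.
  by rewrite normrZ ger0_norm// ler_piMl.
have Vts (s t : R) : 0 <= s <= 1 -> 0 <= t <= 1 -> V (x + s *: v + t *: u).
  by move=> ? ?; rewrite addrAC; exact: Vst.
have [s [t [s01 t01 st]]] := second_difference Vo sf Vst.
have [s' [t' [s01' t01' st']]] := second_difference Vo sf Vts.
exists (x + s *: u + t *: v), (x + s' *: v + t' *: u).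
split; [exact: Vst|exact: Vts|exact: xst| |].
  by rewrite [leRHS]addrC; exact: xst.
by rewrite -st -st' [x + v + u]addrAC; ring.
Qed.

Lemma continuous_dist_lt f x e : {for x, continuous f} -> 0 < e ->
  nbhs x [set y | `|f x - f y| < e].
Proof. by move=> /cvgrPdist_lt cf e0; exact: cf. Qed.

Lemma derive_commute V f x u v : open V -> V x -> smooth V f ->
  'D_u ('D_v f) x = 'D_v ('D_u f) x.
Proof.
move=> Vo Vx sf; set G := 'D_u ('D_v f); set H := 'D_v ('D_u f).
have cG := smooth_continuous (smooth_derive u (smooth_derive v sf)) Vx.
have cH := smooth_continuous (smooth_derive v (smooth_derive u sf)) Vx.
apply/subr0_eq/eqP; rewrite -normr_le0; apply/ler_addgt0Pl => e e0; rewrite addr0.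
have e2 : 0 < e / 2 by rewrite divr_gt0.
have nG := continuous_dist_lt cG e2; have nH := continuous_dist_lt cH e2.
have nV : nbhs x V by exact: open_nbhs_nbhs.
have nVGH : nbhs x (V `&` (_ `&` _)) := filterI nV (filterI nG nH).
have [r /= r0 rP] := (nbhs_ballP _ _).1 (nVGH _ _).
(* Scaling by [s] puts the whole parallelogram in the ball; the summand 1 keeps the denominator
   positive when [u] and [v] vanish. *)
pose s := r / (`|u| + `|v| + 1).
have uv0 : 0 < `|u| + `|v| + 1 by rewrite ltr_wpDl// addr_ge0.
have s0 : 0 < s by rewrite divr_gt0.
have suv : `|s *: u| + `|s *: v| < r.
  rewrite (normrZ s u) (normrZ s v) gtr0_norm// -mulrDr /s mulrAC ltr_pdivrMr// ltr_pM2l//.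
  by rewrite ltrDl.
have rV y : `|x - y| <= `|s *: u| + `|s *: v| -> ball x r y.
  by rewrite -ball_normE /= => /le_lt_trans; exact.
have Bo : open (ball x r) by exact: ball_open.
have BV : ball x r `<=` V by move=> y /rP[].
have sfB := sub_smooth BV sf.
have s20 : s ^+ 2 != 0 by rewrite expf_neq0// gt_eqF.
(* Both mixed derivatives are homogeneous of degree 2 in the scaling, so the factor [s ^+ 2] can be
   cancelled afterwards. *)
have Dscale (w z : E) y : ball x r y ->
    'D_(s *: w) ('D_(s *: z) f) y = s ^+ 2 * 'D_w ('D_z f) y.
  move=> By; have dDf := smooth_differentiable (smooth_derive z sfB).
  have lin (g : E -> R^o) y' : differentiable g y' ->
      forall z', 'D_(s *: z') g y' = s * 'D_z' g y'.
    move=> dg z'; have := derive_linear s z' 0 dg.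
    by rewrite addr0 derive0 addr0.
  have -> : 'D_(s *: w) ('D_(s *: z) f) y = 'D_(s *: w) (s \*: 'D_z f) y.
    apply: (eq_derive_on _ Bo By) => y' By'.
    exact: (lin f y' (smooth_differentiable sfB By') z).
  rewrite deriveZ; last exact: diff_derivable (dDf _ By).
  by rewrite (lin _ _ (dDf _ By)) expr2 -mulrA.
have [p [q [Bp Bq _ _ pq]]] : exists p q : E, [/\ ball x r p, ball x r q,
    `|x - p| <= `|s *: u| + `|s *: v|, `|x - q| <= `|s *: u| + `|s *: v|
    & 'D_(s *: v) ('D_(s *: u) f) p = 'D_(s *: u) ('D_(s *: v) f) q].
  apply: derive_commute_scaled => // a b /andP[a0 a1] /andP[b0 b1]; apply: rV.
  rewrite -addrA opprD addNKr normrN (le_trans (ler_normD _ _))// lerD//.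
    by rewrite [leLHS]normrZ ger0_norm// ler_piMl.
  by rewrite [leLHS]normrZ ger0_norm// ler_piMl.
have E1 : s ^+ 2 * H p = s ^+ 2 * G q :> R.
  exact (etrans (esym (Dscale v u p Bp)) (etrans pq (Dscale u v q Bq))).
clear pq.
have HG : H p = G q :> R := mulfI s20 E1.
clear E1.
have Hp : `|H x - H p| < e / 2 := proj2 (proj2 (rP p Bp)).
have Gq : `|G x - G q| < e / 2 := proj1 (proj2 (rP q Bq)).
rewrite HG distrC in Hp.
apply: (le_trans (ler_distD (G q : R) (G x) (H x))).
rewrite [e]splitr; exact: (lerD (ltW Gq) (ltW Hp)).
Qed.

End mixed_derivatives.

(** * Local calculus of 1- and 2-forms *)

(* Otherwise unification keeps unfolding directional derivatives into limits. *)
Opaque derive.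

(** * Second derivatives of row-valued maps, by coordinates *)

Section vector_valued.
Context {R : realType} {n : nat}.
Local Notation E := 'rV[R]_n.
Variables (V : set E) (m : nat) (F : E -> 'rV[R]_m) (x : E).
Hypotheses (Vo : open V) (Vx : V x) (sF : smooth V F).

Let dF y : V y -> differentiable F y.
Proof. exact: smooth_differentiable. Qed.

Let dDF v y : V y -> differentiable ('D_v F) y.
Proof. exact: smooth_differentiable (smooth_derive v sF). Qed.

Let derive_coord2 u v i :
  ('D_u ('D_v F) x) 0 i = 'D_u ('D_v (fun y => F y 0 i : R^o)) x.
Proof.
rewrite derive_coord; last exact: dDF.
by apply: (eq_derive_on u Vo Vx) => y Vy; apply: derive_coord; exact: dF.
Qed.

Lemma derive_commute_row u v : 'D_u ('D_v F) x = 'D_v ('D_u F) x.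
Proof.
apply/rowP => i; apply: (etrans (derive_coord2 u v i)); apply/esym.
apply: (etrans (derive_coord2 v u i)).
by apply: (derive_commute _ _ Vo Vx); exact: smooth_coord.
Qed.

Let along_coord (Z : E -> E) y i : V y ->
  ('D_(Z y) F y) 0 i = 'D_(Z y) (fun y => F y 0 i : R^o) y.
Proof. by move=> Vy; apply: derive_coord; exact: dF. Qed.

Lemma differentiable_row (G : E -> 'rV[R]_m) y :
  (forall i, differentiable (fun z => G z 0 i : R^o) y) -> differentiable G y.
Proof.
move=> dG.
have GE : (fun z => \sum_i (G z 0 i) *: (delta_mx 0 i : 'rV[R]_m)) = G.
  by apply/funext => z; rewrite -row_sum_delta.
rewrite -GE; apply: differentiable_bigsum => i.
exact: (differentiableZl (delta_mx 0 i : 'rV[R]_m) (dG i)).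
Qed.

Lemma differentiable_derive_along_row (Z : E -> E) :
  differentiable Z x -> differentiable (fun y => 'D_(Z y) F y) x.
Proof.
move=> dZ; apply: differentiable_row => i.
have sFi := smooth_coord i Vo sF.
apply: (@eq_differentiable_on _ _ V _ (fun y => 'D_(Z y) (fun y => F y 0 i : R^o) y)) => //.
  by move=> y Vy; rewrite along_coord.
apply: (@differentiable_apply _ _ V (fun x v => 'D_v (fun y => F y 0 i : R^o) x)) => //.
  by apply: derive_linear_on => y; exact: smooth_differentiable.
by move=> v; exact: (smooth_differentiable (smooth_derive v sFi)).
Qed.

Lemma derive_derive_along_row (Z : E -> E) u : differentiable Z x ->
  'D_u (fun y => 'D_(Z y) F y) x = 'D_u ('D_(Z x) F) x + 'D_('D_u Z x) F x.
Proof.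
move=> dZ; apply/rowP => i.
rewrite derive_coord; last exact: differentiable_derive_along_row.
have -> : 'D_u (fun y => ('D_(Z y) F y) 0 i : R^o) x =
    'D_u (fun y => 'D_(Z y) (fun y => F y 0 i : R^o) y) x.
  by apply: (eq_derive_on u Vo Vx) => y Vy; exact: along_coord.
rewrite (derive_derive_along u Vo Vx (smooth_coord i Vo sF) dZ) mxE derive_coord2.
by rewrite (derive_coord _ _ (dF Vx)).
Qed.

End vector_valued.

(** * Lie derivative, exterior derivative and contraction on an open set *)

Section local_forms.
Context {R : realType} {n : nat}.
Local Notation E := 'rV[R]_n.
Implicit Types (a b : E -> E -> R^o) (w : E -> E -> E -> R^o) (X Y Z : E -> E).

Definition lie1 Y a : E -> E -> R^o :=
  fun x v => 'D_(Y x) (a ^~ v) x + a x ('D_v Y x).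

Definition d1 a : E -> E -> E -> R^o :=
  fun x u v => 'D_u (a ^~ v) x - 'D_v (a ^~ u) x.

Definition lie2 Y w : E -> E -> E -> R^o := fun x u v =>
  'D_(Y x) (fun y => w y u v) x + w x ('D_u Y x) v + w x u ('D_v Y x).

Definition contract Y w : E -> E -> R^o := fun x v => w x (Y x) v.

Variable V : set E.
Hypothesis Vo : open V.

Definition form1 a := linear_on V a /\ forall v, smooth V (a ^~ v).

Definition form2 w :=
  [/\ forall v, linear_on V (fun x u => w x u v),
      forall u, linear_on V (fun x v => w x u v)
    & forall u v, smooth V (fun x => w x u v)].

Lemma form1_differentiable a v x : form1 a -> V x -> differentiable (a ^~ v) x.
Proof. by move=> [_ sa]; exact: smooth_differentiable. Qed.

Lemma form1_derive_apply a Z u x : form1 a -> V x -> differentiable Z x ->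
  'D_u (fun y => a y (Z y)) x = 'D_u (a ^~ (Z x)) x + a x ('D_u Z x).
Proof.
move=> fa Vx dZ; rewrite (derive_apply Vo fa.1)// => v.
exact: form1_differentiable.
Qed.

Lemma linear_onD a x u v : linear_on V a -> V x -> a x (u + v) = a x u + a x v.
Proof. by move=> la Vx; have := la x Vx 1 u v; rewrite scale1r mul1r. Qed.

Lemma eq_lie1 Y a b x v : (forall y u, V y -> a y u = b y u) -> V x ->
  lie1 Y a x v = lie1 Y b x v.
Proof.
move=> ab Vx; rewrite /lie1 ab//; congr (_ + _).
by apply: (eq_derive_on _ Vo Vx) => y Vy; exact: ab.
Qed.

Lemma eq_d1 a b x u v : (forall y u, V y -> a y u = b y u) -> V x ->
  d1 a x u v = d1 b x u v.
Proof.
by move=> ab Vx; congr (_ - _); apply: (eq_derive_on _ Vo Vx) => y Vy; exact: ab.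
Qed.

Lemma eq_lie2 Y w w' x u v : (forall y u v, V y -> w y u v = w' y u v) -> V x ->
  lie2 Y w x u v = lie2 Y w' x u v.
Proof.
move=> ww Vx; congr (_ + _ + _); [|exact: ww|exact: ww].
by apply: (eq_derive_on _ Vo Vx) => y Vy; exact: ww.
Qed.

Lemma form1_lie1 Y a : smooth V Y -> form1 a -> form1 (lie1 Y a).
Proof.
move=> sY fa; have [la sa] := fa; split=> [x Vx c u v|v]; last first.
  apply: smoothD => //; first exact: smooth_derive_along.
  by apply: smooth_apply => //; exact: smooth_derive.
rewrite /lie1 derive_linear ?la//; last exact: smooth_differentiable sY Vx.
have -> : 'D_(Y x) (a ^~ (c *: u + v)) x =
    'D_(Y x) ((c \*: (a ^~ u)) + (a ^~ v)) x.
  by apply: (eq_derive_on _ Vo Vx) => y Vy; rewrite la.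
rewrite deriveD; [|apply: derivableZ|]; try
  exact/diff_derivable/form1_differentiable.
rewrite deriveZ; last exact/diff_derivable/form1_differentiable.
have aux (p q r s : R) : c * p + q + (c * r + s) = c * (p + r) + (q + s) by ring.
exact: aux.
Qed.

Lemma derive_lie1 Y a u v x : smooth V Y -> form1 a -> V x ->
  'D_u (lie1 Y a ^~ v) x = 'D_u ('D_(Y x) (a ^~ v)) x + 'D_('D_u Y x) (a ^~ v) x
    + ('D_u (a ^~ ('D_v Y x)) x + a x ('D_u ('D_v Y) x)).
Proof.
move=> sY fa Vx; have [la sa] := fa.
have sDY v' := smooth_derive v' sY.
rewrite /lie1 deriveD.
- rewrite (derive_derive_along u Vo Vx (sa v) (smooth_differentiable sY Vx)).
  have dDY := smooth_differentiable (sDY v) Vx.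
  by rewrite (@form1_derive_apply a ('D_v Y) u x fa Vx dDY).
- apply/diff_derivable.
  exact: smooth_differentiable (smooth_derive_along Vo (sa v) sY) Vx.
- apply/diff_derivable.
  exact: smooth_differentiable (smooth_apply Vo la sa (sDY v)) Vx.
Qed.

(** Schwarz does all the work: applied to [Y] it cancels the terms [a x ('D_u ('D_v Y) x)] of the
    antisymmetrisation, and applied to [a] it moves the derivative along [Y x] outside. *)
Lemma d1_lie1 Y a u v x : smooth V Y -> form1 a -> V x ->
  d1 (lie1 Y a) x u v = lie2 Y (d1 a) x u v.
Proof.
move=> sY fa Vx; have [la sa] := fa.
rewrite /d1 /lie2 !derive_lie1//.
rewrite (derive_commute u (Y x) Vo Vx (sa v)) (derive_commute v (Y x) Vo Vx (sa u)).
rewrite (derive_commute_row Vo Vx sY u v).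
have -> : 'D_(Y x) (fun y => 'D_u (a ^~ v) y - 'D_v (a ^~ u) y) x =
   'D_(Y x) ('D_u (a ^~ v)) x - 'D_(Y x) ('D_v (a ^~ u)) x.
  rewrite deriveB//; apply: diff_derivable.
    exact: smooth_differentiable (smooth_derive _ (sa v)) Vx.
  exact: smooth_differentiable (smooth_derive _ (sa u)) Vx.
have aux (p q r s p' q' r' : R) : p + q + (r + s) - (p' + q' + (r' + s)) =
  p - p' + (q - r') + (r - q') by ring.
exact: aux.
Qed.

(** An instance of [[L(X), L(Y)] = L([X, Y])] with vanishing bracket. *)
Lemma lie1_commute X Y a v x : smooth V X -> smooth V Y -> form1 a ->
  (forall y, V y -> 'D_(Y y) X y = 'D_(X y) Y y) -> V x ->
  lie1 X (lie1 Y a) x v = lie1 Y (lie1 X a) x v.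
Proof.
move=> sX sY fa XY Vx; have [la sa] := fa.
(* The commutation relation holds on all of [V], so it may be differentiated in direction [v]. *)
have bracket : 'D_v ('D_(Y x) X) x + 'D_('D_v Y x) X x =
    'D_v ('D_(X x) Y) x + 'D_('D_v X x) Y x.
  have dX := smooth_differentiable sX Vx; have dY := smooth_differentiable sY Vx.
  apply: (etrans (esym (derive_derive_along_row Vo Vx sX v dY))).
  apply: (etrans (eq_derive_on v Vo Vx XY)).
  exact: (derive_derive_along_row Vo Vx sY v dX).
have aXY := etrans (esym (linear_onD _ _ la Vx))
  (etrans (congr1 (a x) bracket) (linear_onD _ _ la Vx)).
apply: (etrans (congr1 (+%R^~ _) (derive_lie1 (X x) v sY fa Vx))); apply/esym.
apply: (etrans (congr1 (+%R^~ _) (derive_lie1 (Y x) v sX fa Vx))).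
(* Schwarz matches [P] with [P'], [m'] with [r'] and [m] with [r]; commutation matches [Q] with
   [Q']; the remaining discrepancy is the differentiated bracket identity. *)
have aux (P Q S m t P' Q' S' m' t' r r' : R) : P = P' -> Q' = Q -> m' = r' ->
    m = r -> r' + t' = r + t ->
    P' + Q' + (S' + m') + (S + t') = P + Q + (S + m) + (S' + t).
  by move=> -> -> -> -> rt; apply/subr0_eq; rewrite -(subrr (r + t)) -{1}rt; ring.
exact: (aux _ _ _ _ _ _ _ _ _ _ _ _ (derive_commute (X x) (Y x) Vo Vx (sa v))
  (congr1 (fun z => 'D_z (a ^~ v) x) (XY x Vx))
  (congr1 (a x) (derive_commute_row Vo Vx sX (Y x) v))
  (congr1 (a x) (derive_commute_row Vo Vx sY (X x) v)) aXY).
Qed.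

(** Contraction with [X] commutes with [L(Y)]: in the product rule the term [a x ('D_(Y x) X x)]
    equals [a x ('D_(X x) Y x)] because the bracket vanishes. *)
Lemma lie1_along X Y a x : smooth V X -> smooth V Y -> form1 a ->
  (forall y, V y -> 'D_(Y y) X y = 'D_(X y) Y y) -> V x ->
  lie1 Y a x (X x) = 'D_(Y x) (fun y => a y (X y)) x.
Proof.
move=> sX sY fa XY Vx.
have dX := smooth_differentiable sX Vx.
by rewrite /lie1 (@form1_derive_apply a X (Y x) x fa Vx dX) XY.
Qed.

Lemma form1_contract Y w : smooth V Y -> form2 w -> form1 (contract Y w).
Proof.
move=> sY [lw1 lw2 sw]; split=> [x Vx c u v|v]; first exact: lw2.
by apply: (@smooth_apply _ _ V (fun x u => w x u v)).
Qed.

Lemma derive_contract Y w u v x : smooth V Y -> form2 w -> V x ->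
  'D_u (contract Y w ^~ v) x = 'D_u (fun y => w y (Y x) v) x + w x ('D_u Y x) v.
Proof.
move=> sY [lw1 lw2 sw] Vx.
apply: (@form1_derive_apply (fun x u => w x u v)) => //.
exact: smooth_differentiable sY Vx.
Qed.

(** The vanishing bracket lets [i(Y)] pass through [L(X)]: the derivative of [Y] along [X] becomes
    that of [X] along [Y], as [lie2] requires. *)
Lemma lie1_contract X Y w v x : smooth V Y -> form2 w ->
  (forall y, V y -> 'D_(Y y) X y = 'D_(X y) Y y) -> V x ->
  lie1 X (contract Y w) x v = lie2 X w x (Y x) v.
Proof. by move=> sY fw XY Vx; rewrite /lie1 derive_contract// -XY. Qed.

(** Cartan's formula for a closed form. Closedness at the triple [Y x], [u], [v] trades the
    derivatives of [w] along [u] and [v] for the one along [Y x]; antisymmetry places ['D_v Y x] in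
    the second slot. *)
Lemma lie2_cartan Y w u v x : smooth V Y -> form2 w ->
  (forall y u v, V y -> w y u v = - w y v u) ->
  'D_(Y x) (fun y => w y u v) x - 'D_u (fun y => w y (Y x) v) x
     + 'D_v (fun y => w y (Y x) u) x = 0 -> V x ->
  lie2 Y w x u v = d1 (contract Y w) x u v.
Proof.
move=> sY fw aw cw Vx.
have Eu := derive_contract u v sY fw Vx; have Ev := derive_contract v u sY fw Vx.
apply: (etrans _ (congr2 (fun p q => p - q) (esym Eu) (esym Ev))).
have aux (p q r s t t' : R) : t = - t' -> p - q + s = 0 ->
    p + r + t = q + r - (s + t').
  by move=> -> pqs; apply/subr0_eq; rewrite -pqs; ring.
exact: aux (aw _ _ _ Vx) cw.
Qed.

Lemma lie2_scale X w (f : E -> R^o) u v x :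
  differentiable (fun y => w y u v) x -> differentiable f x ->
  lie2 X (fun y u v => f y * w y u v) x u v =
  'D_(X x) f x * w x u v + f x * lie2 X w x u v.
Proof.
move=> dw df; rewrite /lie2 derive_mul//.
have aux (p q r s t t' : R) : p * q + r * s + p * t + p * t' =
  s * r + p * (q + t + t') by ring.
exact: aux.
Qed.

Lemma lie2_sum X m (w : 'I_m -> E -> E -> E -> R^o) u v x :
  (forall i, differentiable (fun y => w i y u v) x) ->
  lie2 X (fun y u v => \sum_i w i y u v) x u v = \sum_i lie2 X (w i) x u v.
Proof.
by move=> dw; rewrite /lie2 derive_bigsum// -!big_split.
Qed.

Lemma form1_comb m a (c : 'I_m -> R) (b : 'I_m -> E -> E -> R^o) :
  form1 a -> (forall i, form1 (b i)) ->
  form1 (fun x u => a x u - \sum_i c i * b i x u).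
Proof.
move=> [la sa] fb; split=> [x Vx k u v|v].
  rewrite la// (eq_bigr (fun i => k * (c i * b i x u) + c i * b i x v)); last first.
    by move=> i _; rewrite (fb i).1// mulrDr mulrCA.
  by rewrite big_split/= -mulr_sumr; ring.
have sb : smooth V (fun x => \sum_i (c i : R^o) * b i x v : R^o).
  apply: smooth_sum => // i; apply: smoothM => //; first exact: smooth_cst.
  exact: (fb i).2.
have h := smoothD Vo (sa v) (smoothM Vo (smooth_cst V (-1 : R^o)) sb).
by apply: (eq_smooth Vo _ h) => y Vy; rewrite mulN1r.
Qed.

(** The coefficients are numbers, so [d] produces no wedge products with their differentials; the
    assumption that the [f_j] are constant enters here. *)
Lemma d1_comb m a (c : 'I_m -> R) (b : 'I_m -> E -> E -> R^o) x u v :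
  form1 a -> (forall i, form1 (b i)) -> V x ->
  d1 (fun x u => a x u - \sum_i c i * b i x u) x u v =
  d1 a x u v - \sum_i c i * d1 (b i) x u v.
Proof.
move=> fa fb Vx.
have D u' v' : 'D_u' (fun y => a y v' - \sum_i c i * b i y v' : R^o) x =
    'D_u' (a ^~ v') x - \sum_i c i * 'D_u' (b i ^~ v') x.
  have dcb i : differentiable (fun y => (c i : R^o) * b i y v' : R^o) x.
    apply: (differentiable_mul (differentiable_cst (c i : R^o) x)).
    exact: (form1_differentiable v' (fb i) Vx).
  have dS := differentiable_bigsum dcb.
  have da := form1_differentiable v' fa Vx.
  apply: (etrans (deriveB (diff_derivable da) (diff_derivable dS))).
  congr (_ - _); apply: (etrans (derive_bigsum u' dcb)); apply: eq_bigr => i _.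
  rewrite (derive_mul u' (differentiable_cst (c i : R^o) x)); last first.
    exact: (form1_differentiable v' (fb i) Vx).
  by rewrite (derive_cst (c i : R^o)) mulr0 addr0.
apply: (etrans (congr2 (fun p q => p - q) (D u v) (D v u))).
have -> : \sum_i c i * d1 (b i) x u v =
    \sum_i c i * 'D_u (b i ^~ v) x - \sum_i c i * 'D_v (b i ^~ u) x.
  by rewrite -sumrB; apply: eq_bigr => i _; rewrite -mulrBr.
have aux (p q r s : R) : p - q - (r - s) = p - r - (q - s) by ring.
exact: aux.
Qed.

End local_forms.

(** * A criterion for Frechet differentiability *)

Section linear_bounds.
Context {R : realType} {n : nat}.
Local Notation E := 'rV[R]_n.
Implicit Types (b : E -> E -> R^o) (V : set E).

Lemma normr_coord_le (v : E) i : `|v 0 i| <= `|v|.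
Proof.
rewrite [leRHS]/Num.Def.normr/= mx_normrE.
exact: (le_bigmax _ (fun i : 'I_1 * 'I_n => `|v i.1 i.2|) (0, i)).
Qed.

Lemma linear_on_bound V b x : linear_on V b -> V x ->
  forall v, `|b x v| <= (\sum_i `|b x (delta_mx 0 i)|) * `|v|.
Proof.
move=> lb Vx v; rewrite (linear_on_coord lb)// (le_trans (ler_norm_sum _ _ _))//.
rewrite mulr_suml; apply: ler_sum => i _.
by rewrite normrM mulrC ler_wpM2l// normr_coord_le.
Qed.

(** Finite dimension turns continuity in each fixed direction into an estimate uniform over
    directions: it is enough to control the basis vectors. *)
Lemma near_linear_on V b x : open V -> linear_on V b -> V x ->
  (forall v, {for x, continuous (b ^~ v)}) ->
  forall e, 0 < e -> \forall y \near x, forall v, `|b x v - b y v| <= e * `|v|.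
Proof.
move=> Vo lb Vx cb e e0.
(* Dividing by [n.+1] rather than [n] covers dimension 0. *)
have en0 : 0 < e / n.+1%:R by rewrite divr_gt0.
have nb : nbhs x [set y | forall i,
    `|b x (delta_mx 0 i) - b y (delta_mx 0 i)| < e / n.+1%:R].
  have H i := continuous_dist_lt (cb (delta_mx 0 i)) en0.
  exact: (filter_forall (nbhs_filter x) H).
have nV : nbhs x V by exact: open_nbhs_nbhs.
near=> y => v.
have Vy : V y by near: y.
have by_ i : `|b x (delta_mx 0 i) - b y (delta_mx 0 i)| < e / n.+1%:R.
  by move: i; near: y.
rewrite (linear_on_coord lb Vx) (linear_on_coord lb Vy) -sumrB.
rewrite (le_trans (ler_norm_sum _ _ _))//.
apply: (@le_trans _ _ (\sum_(i < n) (e / n.+1%:R * `|v|))).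
  apply: ler_sum => i _; rewrite -mulrBr normrM mulrC ler_pM//.
    exact/ltW/by_.
  exact: normr_coord_le.
rewrite sumr_const card_ord -[leLHS]mulr_natr mulrAC ler_wpM2r//.
rewrite mulrAC ler_pdivrMr// ler_wpM2l ?(ltW e0)//.
by rewrite ler_nat.
Unshelve. all: by end_near. Qed.

Lemma near_linear_bounded V b x : open V -> linear_on V b -> V x ->
  (forall v, {for x, continuous (b ^~ v)}) ->
  exists2 C, 0 <= C & \forall y \near x, forall v, `|b y v| <= C * `|v|.
Proof.
move=> Vo lb Vx cb; exists (\sum_i `|b x (delta_mx 0 i)| + 1).
  by rewrite addr_ge0// sumr_ge0.
have nb := near_linear_on Vo lb Vx cb ltr01.
near=> y => v.
have yv : `|b x v - b y v| <= 1 * `|v| by move: v; near: y.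
have -> : b y v = b x v - (b x v - b y v) by rewrite opprB addrC subrK.
rewrite mulrDl (le_trans (ler_normB _ _))// lerD//.
exact: linear_on_bound lb _ _.
Unshelve. all: by end_near. Qed.

(* The mean value theorem on segments upgrades continuous
   directional derivatives to Frechet differentiability. *)
Lemma differentiable_of_derivable V (f : E -> R^o) b x : open V -> V x ->
  linear_on V b -> (forall v, {for x, continuous (b ^~ v)}) ->
  (forall y v, V y -> is_derive y v f (b y v)) -> differentiable f x.
Proof.
move=> Vo Vx lb cb df.
(* The candidate differential has to be a continuous linear map; writing [b x] as a sum of
   coordinate functions supplies it as ['d l x]. *)
pose l (y : E) : R^o := \sum_i y 0 i * b x (delta_mx 0 i).
have dli i : differentiable (fun y : E => y 0 i * b x (delta_mx 0 i) : R^o) x.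
  apply: differentiable_mul.
    exact: (differentiable_coord x 0 i).
  exact: (differentiable_cst (b x (delta_mx 0 i)) x).
have dl : differentiable l x by exact: differentiable_bigsum.
have [cl _] := (diff_locallyP _ _).1 dl.
have lE v : 'd l x v = b x v.
  rewrite -deriveE// /l derive_bigsum//.
  rewrite (linear_on_coord lb Vx); apply: eq_bigr => i _.
  rewrite derive_mul; [|exact: (differentiable_coord x 0 i)
    |exact: (differentiable_cst (b x (delta_mx 0 i)) x)].
  rewrite derive_cst mulr0 add0r mulrC; congr (_ * _).
  by rewrite -(@derive_coord _ _ _ id)// derive_id.
have fE : f \o shift x = cst (f x) + 'd l x +o_ (0 : E) id.
  apply/eqaddoP => e e0.
  have nb := near_linear_on Vo lb Vx cb e0.
  have nV : nbhs x V by exact: open_nbhs_nbhs.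
  have /nbhs_ballP[r /= r0 rP] : nbhs x [set y | V y /\
      forall v, `|b x v - b y v| <= e * `|v|].
    by near=> y; split; near: y.
  apply/nbhs_ballP; exists r => //= h; rewrite -ball_normE /= sub0r normrN => hr.
  have Bt (t : R) : 0 <= t <= 1 -> ball x r (x + t *: h).
    move=> /andP[t0 t1]; rewrite -ball_normE /= opprD addNKr normrN normrZ.
    by rewrite ger0_norm// (le_lt_trans _ hr)// ler_piMl.
  have [|t t01 ft] := @MVT_line _ _ f x h.
    by move=> t t01; have [Vt _] := rP _ (Bt t t01); have := df _ h Vt => -[].
  have [Vt bt] := rP _ (Bt t t01).
  have -> : (f \o shift x - (cst (f x) + 'd l x)) h = b (x + t *: h) h - b x h.
    rewrite -[b (x + t *: h) h](@derive_val _ _ _ _ _ _ _ (df _ h Vt)) -ft -lE.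
    by rewrite !fctE/= opprD addrA [h + x]addrC.
  by rewrite distrC.
have dfE := diff_unique cl fE.
by apply/diff_locallyP; rewrite dfE.
Unshelve. all: by end_near. Qed.

End linear_bounds.

(** * The Poincare lemma for 1-forms *)

Section poincare.
Context {R : realType} {n : nat}.
Local Notation E := 'rV[R]_n.
Local Notation mu := (@lebesgue_measure R).
Variables (V : set E) (a : E -> E -> R^o) (x0 : E) (r C : R).
Let B : set E := ball x0 r.
Hypotheses (Vo : open V) (fa : form1 V a) (BV : B `<=` V)
  (closed_a : forall y u v, V y -> 'D_u (a ^~ v) y = 'D_v (a ^~ u) y)
  (C0 : 0 <= C)
  (aC : forall y v, B y -> `|a y v| <= C * `|v|)
  (DaC : forall y u v, B y -> `|'D_u (a ^~ v) y| <= C * `|u| * `|v|).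

Definition radial_integrand (x : E) (t : R) : R := a (x0 + t *: (x - x0)) (x - x0).

Definition radial_primitive (x : E) : R^o :=
  \int[mu]_(t in `[0, 1]) radial_integrand x t.

Let ball_segment x (t : R) : B x -> 0 <= t <= 1 -> B (x0 + t *: (x - x0)).
Proof.
move=> + /andP[t0 t1]; rewrite /B -ball_normE /= => xr.
rewrite opprD addNKr normrN normrZ ger0_norm//.
by rewrite (le_lt_trans _ xr)// distrC ler_piMl.
Qed.

Let da x v : B x -> differentiable (a ^~ v) x.
Proof. by move=> Bx; apply: (form1_differentiable v fa); exact: BV. Qed.

Let is_derive_radial x v (t : R) : B x -> 0 <= t <= 1 ->
  is_derive (t : R^o) 1 (fun s : R^o => a (x0 + s *: (x - x0)) v)
    ('D_(x - x0) (a ^~ v) (x0 + t *: (x - x0))).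
Proof.
move=> Bx t01; apply: (is_derive_line (f := a ^~ v)).
by apply/diff_derivable/da; exact: ball_segment.
Qed.

Let continuous_radial x v : B x ->
  {within `[0, 1], continuous (fun t : R => a (x0 + t *: (x - x0)) v : R)}.
Proof.
move=> Bx; apply: derivable_within_continuous => t; rewrite in_itv/= => t01.
by have [] := is_derive_radial v Bx t01.
Qed.

Let integrable_radial x : B x ->
  mu.-integrable `[0, 1] (EFin \o radial_integrand x).
Proof.
move=> Bx; apply: continuous_compact_integrable; first exact: segment_compact.
exact: continuous_radial.
Qed.

(** Differentiation under the integral needs the derivative for every [s] in an interval, not only
    at 0. The vector [x - x0] enters both as base point and as argument: the chain rule at the base
    point gives the factor [t], the product rule the second term. *)
Let derive_integrand x v (t s : R) : B (x + s *: v) -> 0 <= t <= 1 ->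
  is_derive (s : R^o) 1 (fun s : R^o => radial_integrand (x + s *: v) t : R^o)
    (t * 'D_v (a ^~ (x + s *: v - x0)) (x0 + t *: (x + s *: v - x0)) +
     a (x0 + t *: (x + s *: v - x0)) v).
Proof.
move=> Bs t01; pose g (y : E) : E := x0 + t *: (y - x0).
have dZ y : differentiable (fun y : E => y - x0) y.
  by apply: (differentiableB (@ex_diff _ _ _ _ _ _ _ (is_diff_id y))).
have DZ y u : 'D_u (fun y : E => y - x0) y = u.
  by rewrite deriveB ?derive_id ?derive_cst ?subr0.
have dg y : differentiable g y.
  by apply: (differentiableD (differentiable_cst x0 y)); apply: differentiableZ.
have Dg y u : 'D_u g y = t *: u.
  have dtZ := differentiableZ t (dZ y).
  apply: (etrans (deriveD (derivable_cst x0 y u) (diff_derivable dtZ))).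
  rewrite derive_cst add0r; apply: (etrans (deriveZ t (diff_derivable (dZ y)))).
  by rewrite DZ.
have Bg y : B y -> B (g y) by move=> By; exact: ball_segment.
pose b y z := a (g y) z.
have lb : linear_on B b by move=> y By; apply: fa.1; exact/BV/Bg.
have db y z : B y -> differentiable (b ^~ z) y.
  by move=> By; exact: (differentiable_comp (dg y) (da z (Bg y By))).
have Db y z u : B y -> 'D_u (b ^~ z) y = t * 'D_u (a ^~ z) (g y).
  move=> By; apply: (etrans (derive_comp u (dg y) (da z (Bg y By)))).
  have := derive_linear t u 0 (da z (Bg _ By)).
  by rewrite Dg addr0 derive0 addr0.
have Bo : open B by exact: ball_open.
have Es := derive_apply (Z := fun y => y - x0) Bo lb Bs (fun z => db _ z Bs) (dZ _) v.
have ds := differentiable_apply (Z := fun y => y - x0) Bo lb Bs (fun z => db _ z Bs) (dZ _).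
have := is_derive_line (diff_derivable ds).
by rewrite Es Db// DZ.
Qed.

Let derive_primitive x v : B x -> is_derive x v radial_primitive (a x v).
Proof.
move=> Bx; pose z : E := x - x0; pose f s := radial_integrand (x + s *: v).
have xr : `|x - x0| < r by move: Bx; rewrite /B -ball_normE /= distrC.
(* For [s] of absolute value below [d] the point [x + s *: v] stays in the ball; the summand 1
   allows [v = 0]. *)
pose d := (r - `|x - x0|) / (`|v| + 1).
have v1 : 0 < `|v| + 1 by rewrite ltr_wpDl.
have d0 : 0 < d by rewrite divr_gt0// subr_gt0.
have sr (s : R) : s \in `]- d, d[ -> `|x + s *: v - x0| < r.
  rewrite in_itv/= -ltr_norml => sd; rewrite addrAC (le_lt_trans (ler_normD _ _))//.
  rewrite -ltrBrDl normrZ (@le_lt_trans _ _ (`|s| * (`|v| + 1)))//.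
    by rewrite ler_wpM2l// lerDl.
  by rewrite -ltr_pdivlMr.
have sB (s : R) : s \in `]- d, d[ -> B (x + s *: v).
  by move=> /sr; rewrite /B -ball_normE /= distrC.
have I0 : (0 : R) \in `]- d, d[ by rewrite in_itv/= oppr_lt0 d0.
have t01E (t : R) : t \in `[0, 1] -> 0 <= t <= 1 by rewrite in_itv.
pose df (s t : R) : R := t * 'D_v (a ^~ (x + s *: v - x0)) (x0 + t *: (x + s *: v - x0)) +
  a (x0 + t *: (x + s *: v - x0)) v.
have fd (s t : R) : s \in `]- d, d[ -> t \in `[0, 1] ->
    is_derive (s : R^o) 1 (f ^~ t : R^o -> R^o) (df s t).
  by move=> /sB Bs /t01E t01; exact: derive_integrand.
have D1 (s t : R) : s \in `]- d, d[ -> t \in `[0, 1] -> partial1of2 f s t = df s t.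
  by move=> sI tI; rewrite partial1of2E; have [] := fd s t sI tI.
(* Dominating constant: the first term of [df] is at most [C * |v| * r], since [x + s *: v] is
   within [r] of [x0], and the second at most [C * |v|]. *)
pose G := C * `|v| * (r + 1).
have r0 : 0 <= r by rewrite (le_trans (normr_ge0 _) (ltW xr)).
have Gub (s t : R) : s \in `]- d, d[ -> t \in `[0, 1] -> `|partial1of2 f s t| <= G.
  move=> sI tI; rewrite D1// /df; have Bs := sB s sI; have t01 := t01E t tI.
  have /andP[t0 t1] := t01; have By := ball_segment Bs t01.
  rewrite /G mulrDr mulr1 (le_trans (ler_normD _ _))// lerD ?aC//.
  rewrite normrM ger0_norm// (le_trans (ler_piMl (normr_ge0 _) t1))//.
  rewrite (le_trans (DaC _ _ By))// ler_wpM2l ?mulr_ge0//.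
  exact/ltW/sr.
have G0 (t : R) : 0 <= cst G t.
  by rewrite /G mulr_ge0 ?mulr_ge0 ?addr_ge0.
have intG : mu.-integrable `[0, 1] (EFin \o cst G).
  apply: continuous_compact_integrable; first exact: segment_compact.
  by apply: continuous_subspaceT; exact: cst_continuous.
have mI : measurable (`[0, 1]%classic : set R) by exact: measurable_itv.
have intf (s : R) : s \in `]- d, d[ -> mu.-integrable `[0, 1] (EFin \o f s).
  by move=> sI; apply: integrable_radial; exact: sB.
have derf (s t : R) : s \in `]- d, d[ -> t \in `[0, 1] -> derivable (f ^~ t : R^o -> R^o) s 1.
  by move=> sI tI; have [] := fd s t sI tI.
have key := @cvg_differentiation_under_integral R _ _ mu f `[0, 1] mI 0 (- d) d I0
  intf derf (cst G) G0 intG Gub.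
(* Once closedness has exchanged [v] and [z], the integrand at [s = 0] is the derivative of [F],
   whose increment from 0 to 1 is [a x v]. *)
pose F (t : R) : R := t * a (x0 + t *: z) v.
pose dF (t : R) : R := t * 'D_z (a ^~ v) (x0 + t *: z) + a (x0 + t *: z) v.
have isF (t : R) : 0 <= t <= 1 -> is_derive (t : R^o) 1 (F : R^o -> R^o) (dF t).
  move=> t01; have ir := is_derive_radial v Bx t01.
  apply: (is_derive_eq (is_deriveM (is_derive_id (t : R^o) 1) ir)).
  by rewrite /dF /GRing.scale/= mulr1.
have cF (t : R) : 0 <= t <= 1 -> {for t, continuous F}.
  move=> t01; apply/differentiable_continuous/derivable1_diffP.
  by have [] := isF t t01.
have cdF : {within `[0, 1], continuous dF}.
  apply: derivable_within_continuous => t /t01E t01.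
  have [dr _] := is_derive_radial v Bx t01.
  have dD : differentiable ('D_z (a ^~ v)) (x0 + t *: z).
    apply: (smooth_differentiable (smooth_derive z (fa.2 v))).
    exact/BV/ball_segment.
  apply: (@derivableD _ _ _ _ (fun s : R^o => a (x0 + s *: z) v)); last exact: dr.
  by have [] := is_deriveM (is_derive_id (t : R^o) 1) (is_derive_line (diff_derivable dD)).
have -> : a x v = \int[mu]_(t in `[0, 1]) partial1of2 f 0 t.
  rewrite (@eq_Rintegral _ _ _ mu `[0, 1] dF); last first.
    move=> t; rewrite inE => tI; rewrite D1// /df /dF scale0r addr0 -/z.
    have By := BV (ball_segment Bx (t01E t tI)).
    by rewrite (closed_a v z By).
  rewrite /Rintegral (@continuous_FTC2 _ dF F 0 1 ltr01 cdF).
  - rewrite /F -EFinB/= mul0r subr0 mul1r scale1r.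
    by rewrite /z addrC subrK.
  - split.
    + by move=> t t01; have [] := isF t (t01E _ (subset_itv_oo_cc t01)).
    + by apply: cvg_at_right_filter; apply: cF; rewrite lexx ler01.
    + by apply: cvg_at_left_filter; apply: cF; rewrite lexx ler01.
  - move=> t t01; rewrite derive1E.
    by have [_ ->] := isF t (t01E _ (subset_itv_oo_cc t01)).
have fE : (fun h : R => h^-1 *: (\int[mu]_(y in `[0, 1]) f (h + 0) y - \int[mu]_(y in `[0, 1]) f 0 y)) =
    (fun h : R => h^-1 *: (radial_primitive (h *: v + x) - radial_primitive x)).
  apply/funext => h; rewrite /radial_primitive /f addr0 scale0r addr0.
  by rewrite [h *: v + x]addrC.
rewrite fE in key.
by apply: DeriveDef; [apply/cvg_ex; eexists; exact: key|exact/cvg_lim].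
Qed.

(** The integral yields directional derivatives only; as they are linear in the direction and
    continuous in the point, the criterion above gives Frechet differentiability. *)
Lemma radial_primitiveP x : B x -> differentiable radial_primitive x /\
  forall v, 'D_v radial_primitive x = a x v.
Proof.
move=> Bx; split; last by move=> v; have [] := derive_primitive v Bx.
apply: (@differentiable_of_derivable _ _ B _ a) => //.
- exact: ball_open.
- by move=> y By; apply: fa.1; exact: BV.
- by move=> v; apply/differentiable_continuous/da.
Qed.

End poincare.

Lemma poincare (R : realType) (n : nat) (V : set 'rV[R]_n)
    (a : 'rV[R]_n -> 'rV[R]_n -> R^o) (x0 : 'rV[R]_n) :
  open V -> V x0 -> form1 V a ->
  (forall y u v, V y -> 'D_u (a ^~ v) y = 'D_v (a ^~ u) y) ->
  exists2 r, 0 < r & ball x0 r `<=` V /\ exists phi : 'rV[R]_n -> R^o,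
    forall x, ball x0 r x ->
      differentiable phi x /\ forall v, 'D_v phi x = a x v.
Proof.
move=> Vo Vx0 fa closed_a; have [la sa] := fa.
have [C C0 aC] := near_linear_bounded Vo la Vx0 (fun v => smooth_continuous (sa v) Vx0).
(* For a fixed basis argument the derivative is linear in [u], so the uniform bound for linear
   families applies; expanding a general argument [v] then costs the sum of the [K i]. *)
pose Da i (y u : 'rV[R]_n) : R^o := 'D_u (a ^~ (delta_mx 0 i)) y.
have lDa i : linear_on V (Da i).
  by apply: derive_linear_on => y; exact: smooth_differentiable.
have cDa i u : {for x0, continuous (Da i ^~ u)}.
  exact: smooth_continuous (smooth_derive u (sa _)) Vx0.
have /choice[K KP] : forall i, exists K, 0 <= K /\
    nbhs x0 [set y | forall u, `|Da i y u| <= K * `|u|].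
  by move=> i; have [K K0 DK] := near_linear_bounded Vo (lDa i) Vx0 (cDa i); exists K.
have nDa : nbhs x0 [set y | forall i u, `|Da i y u| <= K i * `|u|].
  exact: (filter_forall (nbhs_filter x0) (fun i => (KP i).2)).
have nV : nbhs x0 V by exact: open_nbhs_nbhs.
have /nbhs_ballP[r /= r0 rP] : nbhs x0 [set y | [/\ V y,
    forall v, `|a y v| <= C * `|v| & forall i u, `|Da i y u| <= K i * `|u|]].
  by near=> y; split; near: y.
have K0 : 0 <= \sum_i K i by apply: sumr_ge0 => i _; have [] := KP i.
have BV : ball x0 r `<=` V by move=> y /rP[].
exists r => //; split => //; exists (radial_primitive a x0).
apply: (@radial_primitiveP _ _ V a x0 r (C + \sum_i K i)) => //.
- by rewrite addr_ge0.
- move=> y v /rP[_ + _] => /(_ v)/le_trans; apply.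
  by rewrite ler_wpM2r// lerDl.
- move=> y u v By; have [Vy _ DK] := rP y By.
  have -> : 'D_u (a ^~ v) y = \sum_i v 0 i * Da i y u.
    have -> : 'D_u (a ^~ v) y =
        'D_u (fun y => \sum_i (v 0 i : R^o) * a y (delta_mx 0 i) : R^o) y.
      apply: (eq_derive_on u Vo Vy) => y' Vy'; exact: linear_on_coord la _ Vy' v.
    have dva i := smooth_differentiable (sa (delta_mx 0 i)) Vy.
    rewrite derive_bigsum; last first.
      by move=> i; apply: (differentiable_mul _ (dva i)).
    apply: eq_bigr => i _.
    rewrite (derive_mul u (differentiable_cst (v 0 i : R^o) y) (dva i)).
    by rewrite (derive_cst (v 0 i : R^o)) mulr0 addr0.
  rewrite (le_trans (ler_norm_sum _ _ _))//.
  apply: (@le_trans _ _ ((\sum_i K i) * `|u| * `|v|)); last first.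
    by rewrite !ler_wpM2r// lerDr.
  rewrite -mulrA mulr_suml; apply: ler_sum => i _.
  by rewrite normrM mulrC mulrA ler_pM// normr_coord_le.
Unshelve. all: by end_near. Qed.

(** * Hamiltonian symmetries in a chart *)

Section local_hamiltonian.
Context {R : realType} {n : nat}.
Local Notation E := 'rV[R]_n.
Variables (V : set E) (w : E -> E -> E -> R^o) (X Y : E -> E) (h : E -> R^o).
Hypotheses (Vo : open V) (fw : form2 V w)
  (alt_w : forall x u v, V x -> w x u v = - w x v u)
  (closed_w : forall x p u v, V x -> 'D_p (fun y => w y u v) x -
    'D_u (fun y => w y p v) x + 'D_v (fun y => w y p u) x = 0)
  (sX : smooth V X) (sY : smooth V Y) (sh : smooth V h)
  (XY : forall y, V y -> 'D_(Y y) X y = 'D_(X y) Y y)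
  (X_ham : forall x u, V x -> w x (X x) u = 'D_u h x).

Local Notation beta j := (iter j (lie1 Y) (contract Y w)).

Lemma lie2_hamiltonian x u v : V x -> lie2 X w x u v = 0.
Proof.
move=> Vx; rewrite (lie2_cartan Vo sX fw alt_w _ Vx); last exact: closed_w.
have -> : d1 (contract X w) x u v = d1 (fun y z => 'D_z h y) x u v.
  by apply: (eq_d1 Vo _ _ _ Vx) => y z; exact: X_ham.
by rewrite /d1 (derive_commute u v Vo Vx sh) subrr.
Qed.

Lemma form1_iter_lie1 j : form1 V (beta j).
Proof.
elim: j => [|j IH]; first exact: form1_contract.
by rewrite iterS; exact: form1_lie1.
Qed.

Lemma iter_lie2 j x u v : V x -> iter j.+1 (lie2 Y) w x u v = d1 (beta j) x u v.
Proof.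
elim: j x u v => [|j IH] x u v Vx.
  exact: (lie2_cartan Vo sY fw alt_w (closed_w _ _ _ Vx) Vx).
rewrite [iter j.+1 (lie1 Y) _]iterS (d1_lie1 Vo _ _ sY (form1_iter_lie1 j) Vx).
by rewrite iterS; apply: (eq_lie2 Vo _ _ _ _ Vx) => y u' v'; exact: IH.
Qed.

(** For positive [j] the iterate is an exterior derivative of a smooth 1-form on [V], from which
    smoothness is read off. *)
Lemma smooth_iter_lie2 j u v : smooth V (fun x => iter j (lie2 Y) w x u v).
Proof.
case: j => [|j]; first by have [_ _] := fw; exact.
have [_ sb] := form1_iter_lie1 j.
have s1 := smooth_derive u (sb v); have s2 := smooth_derive v (sb u).
have h1 := smoothD Vo s1 (smoothM Vo (smooth_cst V (-1 : R^o)) s2).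
by apply: (eq_smooth Vo _ h1) => y Vy; rewrite iter_lie2// mulN1r.
Qed.

Lemma lie1_iter_lie1 j x v : V x -> lie1 X (beta j) x v = 0.
Proof.
elim: j x v => [|j IH] x v Vx.
  by apply: (etrans (lie1_contract Vo _ sY fw XY Vx)); exact: lie2_hamiltonian.
rewrite iterS (lie1_commute Vo _ sX sY (form1_iter_lie1 j) XY Vx).
have -> : lie1 Y (lie1 X (beta j)) x v = lie1 Y (fun _ _ => 0) x v.
  by apply: (eq_lie1 Vo _ _ _ Vx) => y u; exact: IH.
by rewrite /lie1 derive_cst addr0.
Qed.

Lemma lie2_iter_lie2 j x u v : V x -> lie2 X (iter j (lie2 Y) w) x u v = 0.
Proof.
case: j => [|j] Vx; first exact: lie2_hamiltonian.
have -> : lie2 X (iter j.+1 (lie2 Y) w) x u v = lie2 X (d1 (beta j)) x u v.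
  by apply: (eq_lie2 Vo _ _ _ _ Vx) => y u' v'; exact: iter_lie2.
rewrite -(d1_lie1 Vo _ _ sX (form1_iter_lie1 j) Vx).
have -> : d1 (lie1 X (beta j)) x u v = d1 (fun _ _ => 0) x u v.
  by apply: (eq_d1 Vo _ _ _ Vx) => y z; exact: lie1_iter_lie1.
by rewrite /d1 !derive_cst subrr.
Qed.

Lemma iter_lie1_hamiltonian j x : (forall y, V y -> 'D_(Y y) h y = 0) -> V x ->
  beta j x (X x) = 0.
Proof.
move=> Yh; elim: j x => [|j IH] x Vx.
  by rewrite /= /contract alt_w// X_ham// Yh// oppr0.
rewrite iterS (lie1_along Vo sX sY (form1_iter_lie1 j) XY Vx).
have -> : 'D_(Y x) (fun y => beta j y (X y)) x = 'D_(Y x) (fun _ => 0 : R^o) x.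
  by apply: (eq_derive_on _ Vo Vx) => y; exact: IH.
exact: derive_cst.
Qed.

End local_hamiltonian.

(** * Forms on a manifold and their expressions in charts *)

Section vcons.
Variable T : Type.
Implicit Types (u v w : T).

Lemma vcons0 k u (f : 'I_k -> T) : vcons u f ord0 = u.
Proof. by rewrite /vcons unlift_none. Qed.

Lemma vconsS k u (f : 'I_k -> T) i : vcons u f (lift ord0 i) = f i.
Proof. by rewrite /vcons liftK. Qed.

Lemma fun_ord1E (f : 'I_1 -> T) : f = fun=> f ord0.
Proof. by apply/funext => i; rewrite (ord1 i). Qed.

Lemma vcons_eta k (f : 'I_k.+1 -> T) : vcons (f ord0) (fun i => f (lift ord0 i)) = f.
Proof.
apply/funext => i; case: (unliftP ord0 i) => [j|] ->; first by rewrite vconsS.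
by rewrite vcons0.
Qed.

Lemma vcons2_eta (f : 'I_2 -> T) : f = vcons (f ord0) (fun=> f (lift ord0 ord0)).
Proof. by rewrite -[LHS]vcons_eta; congr vcons; exact: fun_ord1E. Qed.

Lemma vcons_lift0 k u (f : 'I_k -> T) : (fun j => vcons u f (lift ord0 j)) = f.
Proof. by apply/funext => j; rewrite vconsS. Qed.

Lemma vcons_liftS k u (f : 'I_k.+1 -> T) i :
  (fun j => vcons u f (lift (lift ord0 i) j)) = vcons u (fun j => f (lift i j)).
Proof.
apply/funext => j; case: (unliftP ord0 j) => [j'|] ->.
  have -> : lift (lift ord0 i) (lift ord0 j') = lift ord0 (lift i j').
    by apply: val_inj; rewrite /= /bump /= !add1n ltnS; case: (i <= j')%N.
  by rewrite !vconsS.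
have -> : lift (lift ord0 i) ord0 = ord0 by apply: val_inj; rewrite /= /bump.
by rewrite !vcons0.
Qed.

Lemma dfwith_vcons0 k u v (f : 'I_k -> T) :
  dfwith (vcons u f) ord0 v = vcons v f.
Proof.
apply/funext => i; case: (unliftP ord0 i) => [j|] ->.
  by rewrite dfwithout ?vconsS// neq_lift.
by rewrite dfwithin vcons0.
Qed.

Lemma dfwith_vconsS u v w :
  dfwith (vcons u (fun _ : 'I_1 => w)) (lift ord0 ord0) v = vcons u (fun=> v).
Proof.
apply/funext => i; case: (unliftP ord0 i) => [j|] ->.
  by rewrite (ord1 j) dfwithin vconsS.
by rewrite dfwithout ?vcons0.
Qed.

Lemma dfwith1 u v : dfwith (fun _ : 'I_1 => u) ord0 v = fun=> v.
Proof. by apply/funext => i; rewrite (ord1 i) dfwithin. Qed.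

End vcons.

(** * Curried chart coefficients and change of chart *)

Section chart_expressions.
Context {R : realType} {n : nat} {M : manifold R n}.
Local Notation E := 'rV[R]_n.
Implicit Types (c : mindex M) (X Y : vfield_expr M) (f h : M -> R).

Definition coef1 (alpha : form_expr M 1) c : E -> E -> R^o :=
  fun x u => alpha c x (fun=> u).

Definition coef2 (alpha : form_expr M 2) c : E -> E -> E -> R^o :=
  fun x u v => alpha c x (vcons u (fun=> v)).

Definition fexpr f c : E -> R^o := fun x => f (cinv (mchart c) x).

Lemma coef1_lie Y alpha c : coef1 (lie Y alpha) c = lie1 (Y c) (coef1 alpha c).
Proof.
apply/funext => x; apply/funext => u.
by rewrite /coef1 /lie big_ord1 dfwith1.
Qed.

Lemma coef2_lie Y alpha c : coef2 (lie Y alpha) c = lie2 (Y c) (coef2 alpha c).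
Proof.
apply/funext => x; apply/funext => u; apply/funext => v.
rewrite /coef2 /lie /lie2 big_ord_recl big_ord1 addrA.
by rewrite dfwith_vcons0 dfwith_vconsS vconsS vcons0.
Qed.

Lemma coef1_iter_lie Y alpha c j :
  coef1 (iter j (lie Y) alpha) c = iter j (lie1 (Y c)) (coef1 alpha c).
Proof. by elim: j => //= j <-; exact: coef1_lie. Qed.

Lemma coef2_iter_lie Y alpha c j :
  coef2 (iter j (lie Y) alpha) c = iter j (lie2 (Y c)) (coef2 alpha c).
Proof. by elim: j => //= j <-; exact: coef2_lie. Qed.

Lemma coef1_contraction Y alpha c :
  coef1 (contraction Y alpha) c = contract (Y c) (coef2 alpha c).
Proof. by []. Qed.

Lemma lie_fun X f c x v : lie X (fun_form f) c x v = 'D_(X c x) (fexpr f c) x.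
Proof. by rewrite /lie big_ord0 addr0. Qed.

Lemma ext_d_fun f c x u : ext_d (fun_form f) c x u = 'D_(u ord0) (fexpr f c) x.
Proof. by rewrite /ext_d big_ord1 expr0 mul1r. Qed.

Lemma ext_d1 (alpha : form_expr M 1) c x u v :
  ext_d alpha c x (vcons u (fun=> v)) = d1 (coef1 alpha c) x u v.
Proof.
rewrite /ext_d big_ord_recl big_ord1 expr0 mul1r mulN1r vcons0 vconsS.
rewrite vcons_lift0 vcons_liftS; congr (_ - 'D_v _ x).
by apply/funext => y; rewrite [X in alpha c y X]fun_ord1E vcons0.
Qed.

Lemma ext_d2 (alpha : form_expr M 2) c x p u v :
  ext_d alpha c x (vcons p (vcons u (fun=> v))) =
  'D_p (fun y => coef2 alpha c y u v) x - 'D_u (fun y => coef2 alpha c y p v) x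
  + 'D_v (fun y => coef2 alpha c y p u) x.
Proof.
rewrite /ext_d !big_ord_recl big_ord0 addr0 addrA.
rewrite expr0 mul1r mulN1r expr2 mulN1r opprK mul1r.
rewrite vcons0 !vconsS vcons0 vcons_lift0 !vcons_liftS.
rewrite vcons_lift0; congr (_ - _ + 'D_v _ x); apply/funext => y.
by rewrite [X in vcons p X]fun_ord1E vcons0.
Qed.

Lemma form2_coef2 omega c : differential_form omega ->
  form2 (cimg (mchart c)) (coef2 omega c).
Proof.
move=> [lin _ sm _]; split=> [v x Vx a u u'|u x Vx a v v'|u v]; last exact: sm.
  by have := lin c x Vx (vcons 0 (fun=> v)) ord0 a u u'; rewrite !dfwith_vcons0.
have := lin c x Vx (vcons u (fun=> 0)) (lift ord0 ord0) a v v'.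
by rewrite !dfwith_vconsS.
Qed.

(** Polarisation: expand the vanishing value at the pair [u + v], [u + v]. *)
Lemma coef2_alternating omega c x u v : differential_form omega ->
  cimg (mchart c) x -> coef2 omega c x u v = - coef2 omega c x v u.
Proof.
move=> dom Vx; have [_ alt _ _] := dom; have [l1 l2 _] := form2_coef2 c dom.
have alt0 z : coef2 omega c x z z = 0.
  by apply: (alt c x Vx _ ord0 (lift ord0 ord0)); rewrite ?vcons0 ?vconsS.
have := alt0 (u + v).
rewrite (linear_onD _ _ (l1 (u + v)) Vx) (linear_onD _ _ (l2 u) Vx).
rewrite (linear_onD _ _ (l2 v) Vx) !alt0 add0r addr0.
by move/eqP; rewrite addr_eq0 => /eqP.
Qed.

Lemma coef2_closed omega c x p u v : closed_form omega ->
  cimg (mchart c) x ->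
  'D_p (fun y => coef2 omega c y u v) x - 'D_u (fun y => coef2 omega c y p v) x
  + 'D_v (fun y => coef2 omega c y p u) x = 0.
Proof. by move=> cl Vx; rewrite -ext_d2 cl. Qed.

Lemma smooth_fexprT f c : smooth_fun setT f -> smooth (cimg (mchart c)) (fexpr f c).
Proof. by move=> /(_ c); apply: sub_smooth. Qed.

Lemma hamiltonian_coef2 omega h X c x u : hamiltonian_vector_field omega h X ->
  cimg (mchart c) x -> coef2 omega c x (X c x) u = 'D_u (fexpr h c) x.
Proof.
move=> [_ Xh] Vx; have := Xh c x Vx I (fun=> u).
by rewrite ext_d_fun.
Qed.

Lemma open_chart_preimage c (U : set M) : open U ->
  open [set x | cimg (mchart c) x /\ U (cinv (mchart c) x)].
Proof.
move=> Uo; rewrite openE => x [Vx Ux].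
have nV : nbhs x (cimg (mchart c)).
  by apply: open_nbhs_nbhs; split=> //; exact: cimg_open.
have nU : nbhs x (cinv (mchart c) @^-1` U).
  by apply: (cinv_cont Vx); exact: open_nbhs_nbhs.
exact: (@filterI _ _ (nbhs_filter x) _ _ nV nU).
Qed.

Lemma open_overlap (a b : mindex M) : open (overlap (mchart a) (mchart b)).
Proof. by apply: open_chart_preimage; exact: cdom_open. Qed.

Section overlap.
Variables a b : mindex M.
Local Notation V := (overlap (mchart a) (mchart b)).
Local Notation tau := (transition (mchart a) (mchart b)).

Lemma overlap_cimgl x : V x -> cimg (mchart a) x.
Proof. by case. Qed.

Lemma overlap_cimgr x : V x -> cimg (mchart b) (tau x).
Proof. by move=> [_]; exact: cmap_img. Qed.

Lemma cinv_transition x : V x -> cinv (mchart b) (tau x) = cinv (mchart a) x.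
Proof. by move=> [_]; exact: cmapK. Qed.

Lemma differentiable_transition x : V x -> differentiable tau x.
Proof. exact: smooth_differentiable (mtransition a b). Qed.

Lemma derive_fexpr_transition f x u : V x -> differentiable (fexpr f b) (tau x) ->
  'D_u (fexpr f a) x = 'D_('D_u tau x) (fexpr f b) (tau x).
Proof.
move=> Vx df; apply: (etrans _ (derive_comp u (differentiable_transition Vx) df)).
apply: (eq_derive_on u (@open_overlap a b) Vx) => y Vy.
by rewrite /= /fexpr cinv_transition.
Qed.

Lemma differentiable_fexpr_transition f x : V x ->
  differentiable (fexpr f b) (tau x) -> differentiable (fexpr f a) x.
Proof.
move=> Vx df.
apply: (eq_differentiable_on (@open_overlap a b) Vx _
  (differentiable_comp (differentiable_transition Vx) df)) => y Vy.
by rewrite /= /fexpr cinv_transition.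
Qed.

End overlap.

(** The transformation law isolated from the other clauses of a differential form, so that it can be
    propagated by induction along iterates of [L(Y)]. *)
Definition covariant1 (alpha : form_expr M 1) := forall a b x,
  overlap (mchart a) (mchart b) x -> forall v,
  coef1 alpha a x v = coef1 alpha b (transition (mchart a) (mchart b) x)
    ('D_v (transition (mchart a) (mchart b)) x).

Lemma covariant1_contraction omega Y : differential_form omega -> vector_field Y ->
  covariant1 (contraction Y omega).
Proof.
move=> [_ _ _ tr] [_ Ytr] a b x Vx v.
rewrite /coef1 /contraction (tr a b x Vx); congr (omega b _ _).
apply/funext => i; case: (unliftP ord0 i) => [j|] ->; first by rewrite !vconsS.
by rewrite !vcons0 Ytr.
Qed.

(** Second derivatives of the transition map arise twice: from the form's law differentiated along
    [Y], and from the law of [Y] differentiated along [v]. Schwarz identifies them. *)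
Lemma covariant1_lie alpha Y : (forall c, form1 (cimg (mchart c)) (coef1 alpha c)) ->
  vector_field Y -> covariant1 alpha -> covariant1 (lie Y alpha).
Proof.
move=> fal [sY Ytr] cov a b x Vx v; rewrite !coef1_lie.
set tau := transition (mchart a) (mchart b).
have Oo := @open_overlap a b.
have st : smooth (overlap (mchart a) (mchart b)) tau := mtransition a b.
have Ob y : overlap (mchart a) (mchart b) y -> cimg (mchart b) (tau y).
  exact: overlap_cimgr.
have dt := smooth_differentiable st.
have dYa : differentiable (Y a) x.
  exact: smooth_differentiable (sY a) (overlap_cimgl Vx).
have dYb : differentiable (Y b) (tau x) by exact: smooth_differentiable (sY b) (Ob x Vx).
have dal z y : overlap (mchart a) (mchart b) y ->
    differentiable (coef1 alpha b ^~ z) (tau y).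
  by move=> Vy; exact: (form1_differentiable z (fal b) (Ob y Vy)).
pose g y z := coef1 alpha b (tau y) z.
have lg : linear_on (overlap (mchart a) (mchart b)) g.
  by move=> y Vy; apply: (fal b).1; exact: Ob.
have dg z : differentiable (g ^~ z) x.
  exact: (differentiable_comp (dt x Vx) (dal z x Vx)).
have E1 : 'D_(Y a x) (coef1 alpha a ^~ v) x =
    'D_(Y b (tau x)) (coef1 alpha b ^~ ('D_v tau x)) (tau x) +
    coef1 alpha b (tau x) ('D_(Y a x) ('D_v tau) x).
  apply: (etrans (eq_derive_on (Y a x) Oo Vx (fun y Vy => cov a b y Vy v))).
  apply: (etrans (derive_apply Oo lg Vx dg
    (smooth_differentiable (smooth_derive v st) Vx) (Y a x))).
  congr (_ + _); rewrite Ytr//.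
  exact: (derive_comp (Y a x) (dt x Vx) (dal _ x Vx)).
have E2 : 'D_('D_v tau x) (Y b) (tau x) =
    'D_(Y a x) ('D_v tau) x + 'D_('D_v (Y a) x) tau x.
  apply: (etrans (esym (derive_comp v (dt x Vx) dYb))).
  apply: (etrans (eq_derive_on v Oo Vx (fun y Vy => Ytr a b y Vy))).
  apply: (etrans (derive_derive_along_row Oo Vx st v dYa)).
  by rewrite (derive_commute_row Oo Vx st v (Y a x)).
rewrite /lie1 E1 E2 (cov a b x Vx) (linear_onD _ _ (fal b).1 (Ob x Vx)).
by rewrite addrA.
Qed.

End chart_expressions.

(** * The theorem *)

Section symmetries.
Context {R : realType} {n : nat} {M : manifold R n}.
Local Notation E := 'rV[R]_n.
Variables (omega : form_expr M 2) (h : M -> R) (X Y : vfield_expr M).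
Hypotheses (omega_symplectic : symplectic omega)
  (h_smooth : smooth_fun setT h)
  (X_ham : hamiltonian_vector_field omega h X)
  (Y_vf : vector_field Y)
  (Y_sym : infinitesimal_symmetry X Y).
Local Notation V c := (cimg (@mchart R n M c)).
Local Notation beta c j := (iter j (lie1 (Y c)) (contract (Y c) (coef2 omega c))).

Let Vo c : open (V c). Proof. exact: cimg_open. Qed.

Let fw c : form2 (V c) (coef2 omega c).
Proof. by have [dom _ _] := omega_symplectic; exact: form2_coef2. Qed.

Let alt_w c x u v : V c x -> coef2 omega c x u v = - coef2 omega c x v u.
Proof. by have [dom _ _] := omega_symplectic; exact: coef2_alternating. Qed.

Let closed_w c x p u v : V c x -> 'D_p (fun y => coef2 omega c y u v) x -
  'D_u (fun y => coef2 omega c y p v) x + 'D_v (fun y => coef2 omega c y p u) x = 0.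
Proof. by have [_ dom _] := omega_symplectic; exact: coef2_closed. Qed.

Let sX c : smooth (V c) (X c). Proof. by have [[]] := X_ham. Qed.

Let sY c : smooth (V c) (Y c). Proof. by have [] := Y_vf. Qed.

Let sh c : smooth (V c) (fexpr h c). Proof. exact: smooth_fexprT. Qed.

Let XY c y : V c y -> 'D_(Y c y) (X c) y = 'D_(X c y) (Y c) y.
Proof. by move=> Vy; apply: subr0_eq; exact: Y_sym. Qed.

Let ham c x u : V c x -> coef2 omega c x (X c x) u = 'D_u (fexpr h c) x.
Proof. exact: hamiltonian_coef2. Qed.

Let fbeta c j : form1 (V c) (beta c j).
Proof. exact: form1_iter_lie1. Qed.

Let lie2_zero c j x u v : V c x ->
  lie2 (X c) (iter j (lie2 (Y c)) (coef2 omega c)) x u v = 0.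
Proof.
exact: (lie2_iter_lie2 (@Vo c) (@fw c) (@alt_w c) (@closed_w c) (@sX c) (@sY c)
  (@sh c) (@XY c) (@ham c)).
Qed.

Lemma derivative_along_function (f : M -> R) : smooth_fun setT f ->
  exists2 g : M -> R, smooth_fun setT g &
    forall c x, V c x -> g (cinv (mchart c) x) = 'D_(X c x) (fexpr f c) x.
Proof.
move=> sf; have [idx idxP] := choice (@mcover R n M).
pose g p := 'D_(X (idx p) (cmap (mchart (idx p)) p)) (fexpr f (idx p))
  (cmap (mchart (idx p)) p).
have gE c x : V c x -> g (cinv (mchart c) x) = 'D_(X c x) (fexpr f c) x.
  move=> Vx; set a := idx (cinv (mchart c) x).
  have Ox : overlap (mchart c) (mchart a) x by split => //; exact: idxP.
  have df : differentiable (fexpr f a) (transition (mchart c) (mchart a) x).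
    exact: smooth_differentiable (smooth_fexprT a sf) (overlap_cimgr Ox).
  rewrite (derive_fexpr_transition _ Ox df).
  by have [[_ Xtr] _] := X_ham; rewrite -Xtr.
exists g => // c.
have sDf := smooth_derive_along (@Vo c) (smooth_fexprT c sf) (@sX c).
have sub : [set x | V c x /\ setT (cinv (mchart c) x)] `<=` V c by move=> x [].
apply: (eq_smooth _ _ (sub_smooth sub sDf)).
  by apply: open_chart_preimage; exact: openT.
by move=> x [Vx _] /=; rewrite gE.
Qed.

Variables (N : nat) (f : 'I_N -> M -> R).
Hypotheses (f_smooth : forall j, smooth_fun setT (f j))
  (lieN : form_eq_on setT (iter N (lie Y) omega)
     (form_comb xpredT f (fun j : 'I_N => iter j (lie Y) omega))).

Let lieN_coef c x u v : V c x -> iter N (lie2 (Y c)) (coef2 omega c) x u v =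
  \sum_j fexpr (f j) c x * iter j (lie2 (Y c)) (coef2 omega c) x u v.
Proof.
move=> Vx; rewrite -coef2_iter_lie; apply: (etrans (lieN Vx I _)).
by apply: eq_bigr => j _; rewrite -coef2_iter_lie.
Qed.

Lemma conserved_coefficients :
  independent_forms (fun j : 'I_N => iter j (lie Y) omega) ->
  forall j, conserved_on X setT (f j).
Proof.
move=> indep.
have /choice[g gP] : forall j, exists g : M -> R, smooth_fun setT g /\
    forall c x, V c x -> g (cinv (mchart c) x) = 'D_(X c x) (fexpr (f j) c) x.
  by move=> j; have [g sg gE] := derivative_along_function (f_smooth j); exists g.
suff g0 j p : g j p = 0.
  by move=> j c x Vx _ v; rewrite lie_fun -(gP j).2.
apply: indep => [k|c x Vx _ v]; first exact: (gP k).1.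
rewrite [v]vcons2_eta; set u := v ord0; set u' := v _.
pose w k := iter k (lie2 (Y c)) (coef2 omega c).
have dw k z z' : differentiable (fun y => w k y z z') x.
  have sw := smooth_iter_lie2 (@Vo c) (@fw c) (@alt_w c) (@closed_w c) (@sY c) k z z'.
  exact: smooth_differentiable sw Vx.
have df k : differentiable (fexpr (f k) c) x.
  exact: smooth_differentiable (smooth_fexprT c (f_smooth k)) Vx.
(* [L(X)] annihilates the left side of the relation; the goal becomes the expansion of [L(X)] of its
   right side. *)
apply: (etrans _ (lie2_zero N u u' Vx)).
rewrite (eq_lie2 (@Vo c) (X c) u u' (@lieN_coef c) Vx) lie2_sum; last first.
  by move=> k; exact: (differentiable_mul (df k) (dw k u u')).
apply: eq_bigr => k _; rewrite (lie2_scale _ (dw k u u') (df k)).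
by rewrite lie2_zero// mulr0 addr0 (gP k).2// /w -coef2_iter_lie.
Qed.

Variable C : 'I_N -> R.
Hypotheses (N_ge1 : (1 <= N)%N) (fC : forall j p, f j p = C j)
  (C0 : forall j : 'I_N, j = 0%N :> nat -> C j = 0)
  (Yh : infinitesimal_hamiltonian_symmetry h Y).

(** The sum runs over all [j]: the term [j = 0], where [j.-1] is 0 by truncation, disappears because
    [C j = 0] there. *)
Let gamma c : E -> E -> R^o :=
  fun x u => beta c N.-1 x u - \sum_j C j * beta c j.-1 x u.

Let symmetry_formE c : coef1 (symmetry_form omega Y C) c = gamma c.
Proof.
apply/funext => x; apply/funext => u.
rewrite /coef1 /symmetry_form /form_sub /form_comb /gamma.
congr (_ - _); first by rewrite -coef1_contraction -coef1_iter_lie.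
rewrite big_mkcond/=; apply: eq_bigr => j _.
rewrite -coef1_contraction -coef1_iter_lie.
by case: posnP => // /C0 ->; rewrite mul0r.
Qed.

Let form1_gamma c : form1 (V c) (gamma c).
Proof. by apply: form1_comb => //; exact: cimg_open. Qed.

Let d1_gamma c x u v : V c x -> d1 (gamma c) x u v = 0.
Proof.
move=> Vx; rewrite (d1_comb C u v (fbeta c N.-1) (fun j => fbeta c j.-1) Vx).
have d1b j : d1 (beta c j) x u v = iter j.+1 (lie2 (Y c)) (coef2 omega c) x u v.
  exact/esym/(iter_lie2 (@Vo c) (@fw c) (@alt_w c) (@closed_w c) (@sY c)).
rewrite d1b prednK// lieN_coef//; apply/eqP; rewrite subr_eq0; apply/eqP.
apply: eq_bigr => j _; rewrite /fexpr fC d1b.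
(* At [j = 0] the indices [j.-1.+1] and [j] differ, and both terms vanish with [C j]. *)
by case: (posnP j) => [/C0 ->|/prednK ->//]; rewrite !mul0r.
Qed.

Lemma closed_symmetry_form : closed_form (symmetry_form omega Y C).
Proof.
by move=> c x Vx _ v; rewrite [v]vcons2_eta ext_d1 symmetry_formE d1_gamma.
Qed.

Lemma conserved_potential (U : set M) (phi : M -> R) :
  potential_on (symmetry_form omega Y C) U phi -> conserved_on X U phi.
Proof.
move=> [_ _ dphi] c x Vx Ux v; rewrite lie_fun.
have := dphi c x Vx Ux (fun=> X c x); rewrite ext_d_fun => <-.
have -> : symmetry_form omega Y C c x (fun=> X c x) = gamma c x (X c x).
  by rewrite -symmetry_formE.
have Yhc y : V c y -> 'D_(Y c y) (fexpr h c) y = 0.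
  by move=> Vy; have := Yh Vy I (fun=> 0); rewrite lie_fun.
have b0 j : beta c j x (X c x) = 0.
  exact: (iter_lie1_hamiltonian (@Vo c) (@fw c) (@alt_w c) (@sX c) (@sY c)
    (@XY c) (@ham c) j Yhc Vx).
by rewrite /gamma b0 big1 ?subr0// => j _; rewrite b0 mulr0.
Qed.

(** Carries the equation [d phi = gamma] from the chart where [phi] is built to all others. *)
Let covariant_gamma a b x v : overlap (mchart a) (mchart b) x ->
  gamma a x v = gamma b (transition (mchart a) (mchart b) x)
    ('D_v (transition (mchart a) (mchart b)) x).
Proof.
move=> Ox; have cov j : covariant1 (iter j (lie Y) (contraction Y omega)).
  elim: j => [|j IH].
    by have [dom _ _] := omega_symplectic; exact: covariant1_contraction.
  rewrite iterS; apply: covariant1_lie => // c.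
  by rewrite coef1_iter_lie.
have covb j := cov j a b x Ox v.
rewrite /gamma; congr (_ - _).
  by have := covb N.-1; rewrite !coef1_iter_lie.
by apply: eq_bigr => j _; have := covb j.-1; rewrite !coef1_iter_lie => <-.
Qed.

Lemma local_potential (p : M) : exists (U : set M) (phi : M -> R),
  [/\ U p, potential_on (symmetry_form omega Y C) U phi
    & forall psi : M -> R,
        potential_on (symmetry_form omega Y C) U psi ->
        exists a : R, forall q, U q -> psi q = phi q + a].
Proof.
have [c cp] := mcover p; set x0 := cmap (mchart c) p.
have Vx0 : V c x0 by exact: cmap_img.
have closed_gamma y u v : V c y -> 'D_u (gamma c ^~ v) y = 'D_v (gamma c ^~ u) y.
  by move=> Vy; apply: subr0_eq; exact: d1_gamma.
have [r r0 [BV [F FP]]] := poincare (@Vo c) Vx0 (form1_gamma c) closed_gamma.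
pose U : set M := [set q | cdom (mchart c) q /\ ball x0 r (cmap (mchart c) q)].
pose phi q := F (cmap (mchart c) q).
have Uo : open U.
  rewrite openE => q [cq Bq].
  have n1 : nbhs q (cdom (mchart c)).
    by apply: open_nbhs_nbhs; split=> //; exact: cdom_open.
  have n2 : nbhs q (cmap (mchart c) @^-1` ball x0 r).
    apply: (cmap_cont cq); apply: open_nbhs_nbhs; split=> //; exact: ball_open.
  exact: (@filterI _ _ (nbhs_filter q) _ _ n1 n2).
have phiE z : V c z -> F z = fexpr phi c z.
  by move=> Vz; rewrite /fexpr /phi cinvK.
have dphi_c z : ball x0 r z -> differentiable (fexpr phi c) z /\
    forall v, 'D_v (fexpr phi c) z = gamma c z v.
  move=> Bz; have [dF DF] := FP z Bz; have Vz := BV z Bz; split=> [|v].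
    exact: eq_differentiable_on (@Vo c) Vz phiE dF.
  by rewrite -DF; exact/esym/(eq_derive_on v (@Vo c) Vz phiE).
have dphi b y : V b y -> U (cinv (mchart b) y) -> differentiable (fexpr phi b) y /\
    forall v, 'D_v (fexpr phi b) y = gamma b y v.
  move=> Vy [cy By]; have Oy : overlap (mchart b) (mchart c) y by [].
  have [dp Dp] := dphi_c _ By; split=> [|v].
    exact: differentiable_fexpr_transition Oy dp.
  by rewrite (derive_fexpr_transition _ Oy dp) Dp (covariant_gamma v Oy).
exists U, phi; split.
- by split=> //; exact: ballxx.
- split=> // [b|b y Vy Uy v].
    have Wo : open [set y | V b y /\ U (cinv (mchart b) y)].
      exact: open_chart_preimage.
    (* The directional derivatives of [phi] are coefficients of [gamma], already smooth, so mere
       differentiability of the radial primitive suffices. *)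
    apply: smooth_intro => [y [Vy Uy]|v]; first by have [] := dphi b y Vy Uy.
    have sg : smooth [set y | V b y /\ U (cinv (mchart b) y)] (gamma b ^~ v).
      by apply: sub_smooth ((form1_gamma b).2 v) => y [].
    by apply: (eq_smooth Wo _ sg) => y [Vy Uy]; have [_ ->] := dphi b y Vy Uy.
  rewrite ext_d_fun; have [_ ->] := dphi b y Vy Uy.
  by rewrite [v in LHS]fun_ord1E -symmetry_formE.
- move=> psi [_ spsi dpsi].
  (* The difference of two potentials has zero derivative on the ball; the mean value theorem on the
     segment from [x0] makes it constantly [delta x0]. *)
  pose delta z : R^o := fexpr psi c z - F z.
  have UB z : ball x0 r z -> U (cinv (mchart c) z).
    by move=> Bz; split; [exact/cinv_dom/BV|rewrite cinvK//; exact: BV].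
  have ddelta z : ball x0 r z -> forall v, is_derive z v delta 0.
    move=> Bz v; have [dF DF] := FP z Bz; have Vz := BV z Bz.
    have dpz : differentiable (fexpr psi c) z.
      by apply: (smooth_differentiable (spsi c)); split => //; exact: UB.
    have Dpz : 'D_v (fexpr psi c) z = gamma c z v.
      have := dpsi c z Vz (UB z Bz) (fun=> v); rewrite ext_d_fun => <-.
      by rewrite -symmetry_formE.
    apply: DeriveDef; first by apply: derivableB; exact: diff_derivable.
    rewrite deriveB; [|exact: diff_derivable|exact: diff_derivable].
    by rewrite Dpz DF subrr.
  exists (delta x0) => q [cq Bq]; set z := cmap (mchart c) q.
  have Bt (t : R) : 0 <= t <= 1 -> ball x0 r (x0 + t *: (z - x0)).
    move=> /andP[t0 t1]; move: Bq; rewrite -ball_normE /= => Bq.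
    rewrite opprD addNKr normrN normrZ ger0_norm//.
    by rewrite (le_lt_trans _ Bq)// distrC ler_piMl.
  have [|t t01] := @MVT_line _ _ delta x0 (z - x0).
    by move=> t t01; have [] := ddelta _ (Bt t t01) (z - x0).
  have [_ ->] := ddelta _ (Bt t t01) (z - x0).
  rewrite [x0 + _]addrC subrK => /subr0_eq <-; rewrite /delta /fexpr /z cmapK//.
  by rewrite /phi addrC subrK.
Qed.

End symmetries.

Theorem theorem6 (R : realType) (n : nat) (M : manifold R n)
    (omega : form_expr M 2) (h : M -> R) (X Y : vfield_expr M)
    (N : nat) (f : 'I_N -> M -> R)
    (omega_symplectic : symplectic omega)
    (h_smooth : smooth_fun setT h)
    (X_ham : hamiltonian_vector_field omega h X)
    (Y_vf : vector_field Y)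
    (Y_sym : infinitesimal_symmetry X Y)
    (N_ge1 : (1 <= N)%N)
    (f_smooth : forall j, smooth_fun setT (f j))
    (lieN : form_eq_on setT
       (iter N (lie Y) omega)
       (form_comb xpredT f (fun j : 'I_N => iter j (lie Y) omega)))
    (indep : independent_forms (fun j : 'I_N => iter j (lie Y) omega)) :
  (~ (forall j, is_constant (f j)) ->
    forall j, ~ is_constant (f j) -> conserved_on X setT (f j)) /\
  (forall C : 'I_N -> R,
    (forall j p, f j p = C j) ->
    (forall j : 'I_N, j = 0%N :> nat -> C j = 0) ->
    (exists j, C j <> 0) ->
    infinitesimal_hamiltonian_symmetry h Y ->
    [/\ closed_form (symmetry_form omega Y C),
        forall p : M, exists (U : set M) (phi : M -> R),
          [/\ U p, potential_on (symmetry_form omega Y C) U phi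
            & forall psi : M -> R,
                potential_on (symmetry_form omega Y C) U psi ->
                exists a : R, forall q, U q -> psi q = phi q + a]
      & forall (U : set M) (phi : M -> R),
          potential_on (symmetry_form omega Y C) U phi ->
          conserved_on X U phi]).
Proof.
split=> [_ j _|C fC C0 _ Yh].
  exact: (conserved_coefficients omega_symplectic h_smooth X_ham Y_vf Y_sym f_smooth lieN).
split.
- exact: (closed_symmetry_form omega_symplectic Y_vf lieN N_ge1 fC C0).
- exact: (local_potential omega_symplectic Y_vf lieN N_ge1 fC C0).
- move=> U phi.
  exact: (conserved_potential omega_symplectic X_ham Y_vf Y_sym C0 Yh).
Qed.
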